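(* Let $(\Omega,\mathcal{H},\mathbb{E})$ be a sublinear expectation space, let $\{X_i\}_{i\in\mathbb{N}}\subset\mathcal{H}$ be an i.i.d. sequence on $(\Omega,\mathcal{H},\mathbb{E})$, and let $-\infty<\underline{\mu}\le\overline{\mu}<+\infty$. Then $$\lim_{n\to\infty}\mathbb{E}\left[\varphi\left(\frac{\sum_{i=1}^nX_i}{n}\right)\right]=\max_{\underline{\mu}\le\mu\le\overline{\mu}}\varphi(\mu)\qquad\text{for all }\varphi\in C_b(\mathbb{R})$$ if and only if the following three conditions hold: (i) $\lim_{n\to\infty}\mathbb{E}[\psi_n(X_1)]=0$, where $\psi_n(x)=\sup_{y\in\mathbb{R}}\{n\mathbf{1}_{\{|y|\ge n\}}-n|y-x|\}$ for $x\in\mathbb{R}$; (ii) $\lim_{n\to\infty}\mathbb{E}[(-n\vee X_1)\wedge n]=\overline{\mu}$; (iii) $\lim_{n\to\infty}-\mathbb{E}[(-n\vee (-X_1))\wedge n]=\underline{\mu}$.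
   Context: $\mathbb{N}=\{1,2,\dots\}$; $a\vee b=\max(a,b)$, $a\wedge b=\min(a,b)$; $C_b(\mathbb{R})$ is the space of bounded continuous real functions on $\mathbb{R}$ and $C_{b.Lip}(\mathbb{R}^n)$ the space of bounded Lipschitz real functions on $\mathbb{R}^n$. Sublinear expectation space: $\Omega$ is a set and $\mathcal{H}$ is a linear space of real functions on $\Omega$ containing the constants, such that $X\in\mathcal{H}$ implies $|X|\in\mathcal{H}$, and $X_1,\dots,X_n\in\mathcal{H}$ implies $\varphi(X_1,\dots,X_n)\in\mathcal{H}$ for every $\varphi\in C_{b.Lip}(\mathbb{R}^n)$. Elements of $\mathcal{H}$ are called random variables. A sublinear expectation is a functional $\mathbb{E}:\mathcal{H}\to\mathbb{R}$ such that for all $X,Y\in\mathcal{H}$: (a) $\mathbb{E}[X]\ge\mathbb{E}[Y]$ if $X\ge Y$; (b) $\mathbb{E}[c]=c$ for $c\in\mathbb{R}$; (c) $\mathbb{E}[X+Y]\le\mathbb{E}[X]+\mathbb{E}[Y]$; (d) $\mathbb{E}[\lambda X]=\lambda\mathbb{E}[X]$ for $\lambda\ge0$. The triple $(\Omega,\mathcal{H},\mathbb{E})$ is a sublinear expectation space. Identical distribution: $X,Y\in\mathcal{H}$ are identically distributed if $\mathbb{E}[\varphi(X)]=\mathbb{E}[\varphi(Y)]$ for all $\varphi\in C_{b.Lip}(\mathbb{R})$. Independence: $X_i$ is independent of $(X_1,\dots,X_{i-1})$ under $\mathbb{E}$ if for each $\varphi\in C_{b.Lip}(\mathbb{R}^i)$,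 $$\mathbb{E}[\varphi(X_1,\dots,X_i)]=\mathbb{E}\left[\left.\mathbb{E}[\varphi(x_1,\dots,x_{i-1},X_i)]\right|_{(x_1,\dots,x_{i-1})=(X_1,\dots,X_{i-1})}\right].$$ The sequence $\{X_i\}_{i\in\mathbb{N}}$ is independent if $X_{i+1}$ is independent of $(X_1,\dots,X_i)$ for each $i\ge1$; it is i.i.d. if it is independent and all $X_i$ are identically distributed with $X_1$. Convention for $\varphi\in C_b(\mathbb{R})$: for $\xi\in\mathcal{H}$ there is a unique convex weakly compact set $\mathcal{P}_\xi$ of probability measures on $(\mathbb{R},\mathcal{B}(\mathbb{R}))$ with $\mathbb{E}[\varphi(\xi)]=\sup_{\mu\in\mathcal{P}_\xi}\int\varphi\,d\mu$ for all $\varphi\in C_{b.Lip}(\mathbb{R})$ (known result). For $\varphi\in C_b(\mathbb{R})$, $\mathbb{E}[\varphi(\xi)]$ is understood as $\sup_{\mu\in\mathcal{P}_\xi}\int\varphi\,d\mu$ (which agrees with the value of $\mathbb{E}$ whenever $\varphi(\xi)\in\mathcal{H}$). *)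

(* Defs.v *)
From mathcomp Require Import all_boot all_order all_algebra.
From mathcomp Require Import all_classical all_reals all_analysis.

Set Implicit Arguments.
Unset Strict Implicit.
Unset Printing Implicit Defensive.

Import Order.TTheory GRing.Theory Num.Theory.
Import numFieldNormedType.Exports.

Local Open Scope classical_set_scope.
Local Open Scope ring_scope.

(* C_b(R) *)
Definition Cb (R : realType) : set (R -> R) :=
  [set phi | continuous phi /\ bounded_fun phi].

(* C_{b.Lip}(V).  On V = 'rV[R]_n the library norm is the sup norm; all norms
   on R^n give the same class. *)
Definition CbLip (R : realType) (V : normedModType R) : set (V -> R) :=
  [set phi | lipschitz phi /\ bounded_fun phi].

Record rv_space (R : realType) (Omega : Type) (H : set (Omega -> R)) : Prop :=
  RVSpace {
    rv_cst : forall c : R, H (fun=> c);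
    rv_add : forall X Y, H X -> H Y -> H (fun w => X w + Y w);
    rv_scale : forall (a : R) X, H X -> H (fun w => a * X w);
    rv_abs : forall X, H X -> H (fun w => `|X w|);
    rv_comp : forall (n : nat) (X : 'I_n.+1 -> Omega -> R)
        (phi : 'rV[R]_n.+1 -> R),
      (forall i, H (X i)) -> CbLip phi ->
      H (fun w => phi (\row_i X i w)) }.

(* The functional is a total function on Omega -> R, but it is constrained, and
   below it is evaluated, only on H. *)
Record sublinear_expectation (R : realType) (Omega : Type)
    (H : set (Omega -> R)) (E : (Omega -> R) -> R) : Prop :=
  SublinearExpectation {
    sle_monotone : forall X Y, H X -> H Y -> (forall w, Y w <= X w) ->
      E Y <= E X;
    sle_cst : forall c : R, E (fun=> c) = c;
    sle_subadditive : forall X Y, H X -> H Y ->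
      E (fun w => X w + Y w) <= E X + E Y;
    sle_poshom : forall (a : R) X, H X -> 0 <= a ->
      E (fun w => a * X w) = a * E X }.

Definition identically_distributed (R : realType) (Omega : Type)
    (E : (Omega -> R) -> R) (X Y : Omega -> R) : Prop :=
  forall phi : R -> R, CbLip (phi : R^o -> R) ->
    E (fun w => phi (X w)) = E (fun w => phi (Y w)).

(* Y is independent of the random vector Z; this is not symmetric in Y and Z.
   [row_mx z y%:M] is the vector (z, y) of R^(n + 1). *)
Definition independent_of (R : realType) (Omega : Type)
    (E : (Omega -> R) -> R) (n : nat) (Y : Omega -> R)
    (Z : Omega -> 'rV[R]_n) : Prop :=
  forall phi : 'rV[R]_(n + 1) -> R, CbLip phi ->
    E (fun w => phi (row_mx (Z w) (Y w)%:M)) =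
    E (fun w => let g z := E (fun w' => phi (row_mx z (Y w')%:M)) in g (Z w)).

(* Sequences are indexed from 0: [X i] stands for X_{i+1}. *)
Definition iid (R : realType) (Omega : Type) (E : (Omega -> R) -> R)
    (X : nat -> Omega -> R) : Prop :=
  (forall i, independent_of E (X i.+1) (fun w => \row_(j < i.+1) X j w)) /\
  (forall i, identically_distributed E (X i) (X 0%N)).

Definition real_prob (R : realType) := probability (measurableTypeR R) R.

Definition weak_embedding (R : realType) (mu : real_prob R) :
    {ptws set_type (@Cb R) -> R^o} :=
  fun phi => (\int[mu]_x (val phi) x)%R.

(* Weak topology: the coarsest one making mu |-> \int phi dmu continuous for
   every phi in C_b(R). *)
Definition weakly_compact (R : realType) (P : set (real_prob R)) : Prop :=
  compact (P : set (initial_topology (@weak_embedding R))).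

(* Elements of [real_prob R] are functions on all sets, whose values matter only
   on Borel sets; the mixture is therefore characterised on Borel sets. *)
Definition convex_prob_set (R : realType) (P : set (real_prob R)) : Prop :=
  forall (mu nu rho : real_prob R) (t : R), P mu -> P nu -> 0 <= t <= 1 ->
    (forall A : set (measurableTypeR R), measurable A ->
       rho A = (t%:E * mu A + (1 - t)%:E * nu A)%E) ->
    P rho.

Definition represents (R : realType) (Omega : Type) (E : (Omega -> R) -> R)
    (xi : Omega -> R) (P : set (real_prob R)) : Prop :=
  forall phi : R -> R, CbLip (phi : R^o -> R) ->
    E (fun w => phi (xi w)) = sup [set (\int[mu]_x phi x)%R | mu in P].

(* The set P_xi.  For xi in H there is exactly one set with these properties, so
   that neither the choice made by [xget] nor its default value matters. *)
Definition law_set (R : realType) (Omega : Type) (E : (Omega -> R) -> R)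
    (xi : Omega -> R) : set (real_prob R) :=
  xget set0 [set P | [/\ convex_prob_set P, weakly_compact P
                       & represents E xi P]].

(* E[phi(xi)] for phi in C_b(R), where phi(xi) need not be in H. *)
Definition expect_Cb (R : realType) (Omega : Type) (E : (Omega -> R) -> R)
    (phi : R -> R) (xi : Omega -> R) : R :=
  sup [set (\int[mu]_x phi x)%R | mu in law_set E xi].

Definition psi (R : realType) (n : nat) (x : R) : R :=
  sup (range (fun y : R =>
    n%:R * \1_[set z : R | n%:R <= `|z|] y - n%:R * `|y - x|)).

(* Main.v *)
From HB Require Import structures.
Require Import Defs.
From mathcomp Require Import all_boot all_order all_algebra.
From mathcomp Require Import all_classical all_reals all_analysis.
From mathcomp Require Import measurable_realfun ring lra.

Set Implicit Arguments.
Unset Strict Implicit.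
Unset Printing Implicit Defensive.

Import Order.TTheory GRing.Theory Num.Theory.
Import numFieldNormedType.Exports.

Local Open Scope classical_set_scope.
Local Open Scope ring_scope.

(** Averages of i.i.d. variables under a sublinear expectation.

    Let [T f s = E (f (s + X_1))].  Independence, applied to the last variable of
    a sum again and again, gives [E (f (s + X_1 + ... + X_k)) = T^k f s]; so the
    statement is about iterates of a single sublinear, monotone operator on
    bounded Lipschitz functions, and never needs measures on a product space.

    Sufficiency.  Truncate the variables at [n].  A union bound replaces the
    truncated sum by the original one at a cost proportional to
    [E (psi n X_1)], and the same tails, averaged over [k <= n], show that the
    second moment of the truncated variable is [o(n)].  Write [lo_n] and [up_n]
    for the lower and upper means of the truncated variable.  A quadratic bound
    on [f] is preserved by [T] up to one variance: when [(s - a)^2] is expanded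
    around a mean [m] in [[lo_n, up_n]], the linear term has expectation 0 for one
    of the two extreme values of [m] (upper bounds), and nonnegative expectation
    for every [m] in the interval (lower bounds).  After [n] steps the variances
    add up to [o(n^2)], and the expectation of [f] at the average is asymptotically
    at least the value of [f] at any point of [[lo_n, up_n]], and at most its
    maximum over this interval.  This is [weak_law]; it compares with [lo_n] and
    [up_n] for the same [n], so that it serves both directions.

    Necessity.  Once the tails are known to vanish, [weak_law] with the test
    functions [x] and [- x], cut off far away, identifies the limits of [up_n] and
    [lo_n].  The tails vanish because of Ottaviani's argument for one big jump
    ([iter_transition_big_jump]): if the walk jumps by a large multiple of [n], it
    ends far away with probability at least 1/2, whatever happens before and after
    the jump; since it has [n] occasions to jump and the average stays bounded, [n]
    times the upper probability of one such jump tends to 0.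

    From test functions to [C_b(R)].  The expectation of a function in [C_b(R)] is
    a supremum over a convex, weakly compact set of laws, and one has to know that
    such a set exists ([law_set_represents]).  It is the set of all probabilities
    dominated by the given sublinear functional.  The functional is their supremum
    by the Hahn-Banach theorem, which yields positive linear functionals, and by
    the Riesz representation on the real line ([riesz]), where tightness comes
    from the integrability of the variable.  Compactness uses [riesz] once more,
    for the limits of integrals along an ultrafilter.  After that, a function in
    [C_b(R)] is bounded from both sides by Lipschitz functions that are almost
    exact where it matters ([wall_majorant]). *)

(** * Bounded, continuous and Lipschitz functions of one real variable *)

Definition bdd (R : realType) (f : R -> R) : Prop :=
  exists B, forall x, `|f x| <= B.

Definition lip (R : realType) (f : R -> R) : Prop :=
  exists k, forall x y, `|f x - f y| <= k * `|x - y|.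

Definition bounded_lip (R : realType) (f : R -> R) : Prop := lip f /\ bdd f.

Section Functions.
Context (R : realType).
Implicit Types f g : R -> R.

Lemma bddP f : bounded_fun (f : R -> R^o) <-> bdd f.
Proof.
split=> [[M [_ fM]]|[B fB]].
  by exists (M + 1) => x; apply: (fM (M + 1)) => //; rewrite ltrDl.
exists B; split=> [|x Bx y _ /=]; first exact: num_real.
by apply: le_trans (fB y) _; exact: ltW.
Qed.

Lemma bdd_cst c : bdd (fun=> c : R).
Proof. by exists `|c|. Qed.

Lemma bdd_add f g : bdd f -> bdd g -> bdd (fun x => f x + g x).
Proof.
move=> [A fA] [B gB]; exists (A + B) => x.
by apply: le_trans (ler_normD _ _) _; exact: lerD.
Qed.

Lemma bdd_scale a f : bdd f -> bdd (fun x => a * f x).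
Proof.
by move=> [A fA]; exists (`|a| * A) => x; rewrite normrM ler_wpM2l.
Qed.

Lemma bdd_comp f g : bdd f -> bdd (fun x => f (g x)).
Proof. by move=> [A fA]; exists A. Qed.

Lemma bdd_itv f a b : (forall x, a <= f x <= b) -> bdd f.
Proof.
move=> H; exists (`|a| + `|b|) => x; have /andP[ax xb] := H x.
rewrite ler_norml; have := ler_norm b; have := ler_norm (- a).
rewrite normrN; have := normr_ge0 a; have := normr_ge0 b; lra.
Qed.

Lemma lip_posk f : lip f -> exists2 k, 0 < k &
  forall x y, `|f x - f y| <= k * `|x - y|.
Proof.
move=> [k fk]; exists (Num.max k 1); first by rewrite lt_max ltr01 orbT.
by move=> x y; apply: le_trans (fk x y) _; rewrite ler_wpM2r// le_max lexx.
Qed.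

Lemma lip_cst c : lip (fun=> c : R).
Proof. by exists 0 => x y; rewrite subrr normr0 mul0r. Qed.

Lemma lip_id : lip (@idfun R).
Proof. by exists 1 => x y; rewrite mul1r. Qed.

Lemma lip_add f g : lip f -> lip g -> lip (fun x => f x + g x).
Proof.
move=> [k fk] [l gl]; exists (k + l) => x y.
rewrite opprD addrACA mulrDl; apply: le_trans (ler_normD _ _) _.
exact: lerD.
Qed.

Lemma lip_scale a f : lip f -> lip (fun x => a * f x).
Proof.
move=> [k fk]; exists (`|a| * k) => x y.
by rewrite -mulrBr normrM -mulrA ler_wpM2l.
Qed.

Lemma lip_divr a : lip (fun x : R => x / a).
Proof.
rewrite (_ : (fun x => x / a) = fun x => a^-1 * x); last first.
  by apply/funext => x; rewrite mulrC.
by apply: lip_scale; exact: lip_id.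
Qed.

Lemma lip_opp f : lip f -> lip (fun x => - f x).
Proof.
by move=> [k fk]; exists k => x y; rewrite -opprD normrN.
Qed.

Lemma lip_norm f : lip f -> lip (fun x => `|f x|).
Proof.
move=> [k fk]; exists k => x y; apply: le_trans (fk x y).
exact: ler_dist_dist.
Qed.

Lemma lip_comp f g : lip f -> lip g -> lip (fun x => f (g x)).
Proof.
move=> /lip_posk[k k0 fk] [l gl]; exists (k * l) => x y.
by apply: le_trans (fk _ _) _; rewrite -mulrA ler_wpM2l// ltW.
Qed.

Lemma lip_max f g : lip f -> lip g -> lip (fun x => Num.max (f x) (g x)).
Proof.
move=> lf lg.
have -> : (fun x => Num.max (f x) (g x)) =
    (fun x => 2^-1 * ((f x + g x) + `|f x + - g x|)).
  apply/funext => x; rewrite maxr_absE; lra.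
do 2?[apply: lip_scale || apply: lip_add] => //; first exact: lip_add.
by apply: lip_norm; apply: lip_add => //; exact: lip_opp.
Qed.

Lemma lip_min f g : lip f -> lip g -> lip (fun x => Num.min (f x) (g x)).
Proof.
move=> lf lg.
have -> : (fun x => Num.min (f x) (g x)) =
    (fun x => - Num.max (- f x) (- g x)).
  by apply/funext => x; rewrite oppr_max !opprK.
by apply: lip_opp; apply: lip_max; exact: lip_opp.
Qed.

Lemma lip_continuous f : lip f -> continuous f.
Proof.
move=> /lip_posk[k k0 fk] x; apply/cvgrPdist_le => e e0.
near=> y; apply: le_trans (fk _ _) _; rewrite -ler_pdivlMl//.
by near: y; apply: cvgr_dist_le => //; rewrite mulr_gt0// invr_gt0.
Unshelve. all: by end_near. Qed.

Lemma CbP f : Cb f <-> continuous f /\ bdd f.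
Proof. by split=> -[cf /bddP bf]. Qed.

Lemma lip_Cb f : lip f -> bdd f -> Cb f.
Proof. by move=> lf bf; apply/CbP; split => //; exact: lip_continuous. Qed.

Lemma Cb_cst c : Cb (fun=> c : R).
Proof. by apply: lip_Cb; [exact: lip_cst|exact: bdd_cst]. Qed.

Lemma Cb_add f g : Cb f -> Cb g -> Cb (fun x => f x + g x).
Proof.
move=> /CbP[cf bf] /CbP[cg bg]; apply/CbP; split; last exact: bdd_add.
by move=> x; apply: cvgD; [exact: cf|exact: cg].
Qed.

Lemma Cb_scale a f : Cb f -> Cb (fun x => a * f x).
Proof.
move=> /CbP[cf bf]; apply/CbP; split; last exact: bdd_scale.
by move=> x; apply: cvgM; [exact: cvg_cst|exact: cf].
Qed.

Lemma bounded_lip_Cb f : bounded_lip f -> Cb f.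
Proof. by move=> [lf bf]; exact: lip_Cb. Qed.

Lemma bounded_lip_cst (c : R) : bounded_lip (fun=> c).
Proof. by split; [exact: lip_cst|exact: bdd_cst]. Qed.

Lemma bounded_lip_add f g : bounded_lip f -> bounded_lip g ->
  bounded_lip (fun x => f x + g x).
Proof. by move=> [lf bf] [lg bg]; split; [exact: lip_add|exact: bdd_add]. Qed.

Lemma bounded_lip_scale a f : bounded_lip f -> bounded_lip (fun x => a * f x).
Proof. by move=> [lf bf]; split; [exact: lip_scale|exact: bdd_scale]. Qed.

Lemma bounded_lip_opp f : bounded_lip f -> bounded_lip (fun x => - f x).
Proof.
move=> /(bounded_lip_scale (- 1)); congr bounded_lip.
by apply/funext => x; rewrite mulN1r.
Qed.

Lemma bounded_lip_comp f g : bounded_lip f -> lip g ->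
  bounded_lip (fun x => f (g x)).
Proof. by move=> [lf bf] lg; split; [exact: lip_comp|exact: bdd_comp]. Qed.

Lemma CbLipP f : CbLip (f : R^o -> R) <-> bounded_lip f.
Proof.
split=> [[[M [_ fM]] /bddP bf]|[[k fk] /bddP bf]]; split => //.
  exists (M + 1) => x y; have : M < M + 1 by rewrite ltrDl.
  by move/fM => /(_ (x, y)); apply.
exists k; split=> [|l kl [x y] _ /=]; first exact: num_real.
by apply: le_trans (fk x y) _; rewrite ler_wpM2r// ltW.
Qed.

(** The second point may lie outside the interval, so that [a = b] is continuity
    at one point. *)
Lemma heine f (a b e : R) : continuous f -> 0 < e ->
  exists2 d, 0 < d & forall x y, a <= x <= b -> `|x - y| < d -> `|f x - f y| < e.
Proof.
move=> cf e0.
have /compact_near_coveringP/(_ R (0^'+)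
  (fun d x => forall y, `|x - y| < d -> `|f x - f y| < e)) :=
  @segment_compact R a b.
case.
  move=> x _.
  have : \forall z \near x, `|f x - f z| < e / 2.
    by have /cvgrPdist_lt := cf x; apply; lra.
  move=> /nbhs_ballP[r /= r0 fr].
  have {}fr y : `|x - y| < r -> `|f x - f y| < e / 2 by exact: fr.
  near=> z d => /= y zy.
  have xz : `|x - z| < r / 2 by near: z; apply: cvgr_dist_lt => //; lra.
  have dr : d < r / 2 by near: d; apply: nbhs_right_lt; lra.
  have fz : `|f x - f z| < e / 2 by apply: fr; lra.
  have fy : `|f x - f y| < e / 2.
    by apply: fr; have := ler_distD z x y; lra.
  by have := ler_distD (f x) (f z) (f y); rewrite (distrC (f z) (f x)); lra.
move=> r /= r0 H; exists (r / 2); first by lra.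
move=> x y xab xy; have Hd : ball_ Num.norm 0 r (r / 2).
  by rewrite /= sub0r normrN gtr0_norm; lra.
have r20 : 0 < r / 2 by lra.
by apply: (H _ Hd r20) xy; rewrite /= in_itv.
Unshelve. all: by end_near. Qed.

End Functions.

(** * Hahn-Banach: linear minorants of a sublinear functional *)

Definition sublinear_on (R : realType) (V : lmodType R) (D : set V)
    (q : V -> R) : Prop :=
  (forall u v, D u -> D v -> q (u + v) <= q u + q v) /\
  (forall a u, D u -> 0 <= a -> q (a *: u) = a * q u).

(** When [q] is sublinear and [c <= q h], this is the largest sublinear minorant of [q] whose value at
    [- h] is at most [- c]. *)
Definition tilt (R : realType) (V : lmodType R) (q : V -> R) (h : V) (c : R)
    (u : V) : R :=
  inf [set q (u + t *: h) - t * c | t in [set t | 0 <= t]].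

Section HahnBanach.
Context (R : realType) (V : lmodType R) (D : set V).
Hypothesis Dlin : forall a u v, D u -> D v -> D (a *: u + v).
Implicit Types u v h : V.

Lemma sublinear_on0 q u : sublinear_on D q -> D u -> q 0 = 0.
Proof. by move=> [_ qZ] Du; rewrite -(scale0r u) qZ// mul0r. Qed.

Let Dadd u v : D u -> D v -> D (u + v).
Proof. by move=> Du Dv; rewrite -[u]scale1r; exact: Dlin. Qed.

Let D0 u : D u -> D 0.
Proof. by move=> Du; rewrite -(subrr u) addrC -scaleN1r; exact: Dlin. Qed.

Let Dscale a u : D u -> D (a *: u).
Proof. by move=> Du; rewrite -[_ *: _]addr0; apply: Dlin => //; exact: D0 Du. Qed.

Section Tilt.
Variables (q : V -> R) (h : V) (c : R).
Hypotheses (qsub : sublinear_on D q) (Dh : D h) (ch : c <= q h).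

Let lb_tilt u t : D u -> 0 <= t -> - q (- u) <= q (u + t *: h) - t * c.
Proof.
case: qsub => qD qZ Du t0.
have Du' : D (- u) by rewrite -scaleN1r; exact: Dscale.
have := qD _ _ (Dadd Du (Dscale t Dh)) Du'.
rewrite addrAC subrr add0r qZ//.
have : t * c <= t * q h by rewrite ler_wpM2l.
lra.
Qed.

Lemma tilt_le u t : D u -> 0 <= t -> tilt q h c u <= q (u + t *: h) - t * c.
Proof.
move=> Du t0; apply: ge_inf; last by exists t.
by exists (- q (- u)) => _ [s s0 <-]; exact: lb_tilt.
Qed.

Lemma le_tilt u x : (forall t, 0 <= t -> x <= q (u + t *: h) - t * c) ->
  x <= tilt q h c u.
Proof.
move=> H; apply: lb_le_inf; first by exists (q (u + 0 *: h) - 0 * c); exists 0 => /=.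
by move=> _ [t t0 <-]; exact: H.
Qed.

Lemma tilt_sublinear : sublinear_on D (tilt q h c).
Proof.
have [qD qZ] := qsub; split=> [u v Du Dv|a u Du].
  rewrite -lerBlDr; apply: le_tilt => t t0; rewrite lerBlDr [leRHS]addrC -lerBlDr.
  apply: le_tilt => s s0; rewrite lerBlDr.
  have ts0 : 0 <= t + s by exact: addr_ge0.
  apply: le_trans (tilt_le (Dadd Du Dv) ts0) _.
  have := qD _ _ (Dadd Du (Dscale t Dh)) (Dadd Dv (Dscale s Dh)).
  rewrite addrACA -scalerDl; lra.
have pos b v : D v -> 0 < b -> tilt q h c (b *: v) <= b * tilt q h c v.
  move=> Dv b0; rewrite -ler_pdivrMl//; apply: le_tilt => t t0.
  rewrite ler_pdivrMl// mulrBr mulrA -qZ//; last 2 first.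
  - by apply: Dadd => //; exact: Dscale.
  - exact: ltW.
  rewrite scalerDr scalerA; apply: tilt_le; first exact: Dscale.
  by rewrite mulr_ge0// ltW.
rewrite le_eqVlt => /predU1P[<-|a0].
  rewrite scale0r mul0r; apply/eqP; rewrite eq_le; apply/andP; split.
    have := tilt_le (D0 Du) (lexx 0).
    by rewrite scale0r addr0 mul0r subr0 (sublinear_on0 qsub Du).
  apply: le_tilt => t t0; have := lb_tilt (D0 Du) t0.
  by rewrite oppr0 (sublinear_on0 qsub Du) oppr0.
apply/eqP; rewrite eq_le pos//=.
have := pos a^-1 (a *: u) (Dscale a Du).
rewrite invr_gt0 => /(_ a0).
by rewrite scalerA mulVf ?gt_eqF// scale1r ler_pdivlMl.
Qed.

End Tilt.

(** A minimal sublinear functional is linear, since each of its tilts is again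
    a sublinear minorant; the linear functional is a minimal minorant of the
    tilt of [p] along [v], which forces the value [p v] at [v]. *)
Lemma hahn_banach (p : V -> R) (v : V) : sublinear_on D p -> D v ->
  exists L : V -> R,
    [/\ forall u w, D u -> D w -> L (u + w) = L u + L w,
        forall a u, D u -> L (a *: u) = a * L u,
        forall u, D u -> L u <= p u & L v = p v].
Proof.
move=> psub Dv; have [pD pZ] := psub.
have DN u : D u -> D (- u) by move=> Du; rewrite -scaleN1r; exact: Dscale.
have subN (q : V -> R) u : sublinear_on D q -> D u -> - q (- u) <= q u.
  move=> qs Du; have := qs.1 _ _ Du (DN _ Du).
  rewrite subrr (sublinear_on0 qs Du); lra.
pose p' := tilt p v (p v).
have p'sub : sublinear_on D p' by exact: tilt_sublinear.
have p'le u : D u -> p' u <= p u.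
  move=> Du; have := tilt_le psub Dv (lexx _) Du (lexx 0).
  by rewrite scale0r addr0 mul0r subr0.
pose T := {q : V -> R | sublinear_on D q /\ forall u, D u -> q u <= p' u}.
pose ord : rel T := fun q r => `[< forall u, D u -> sval r u <= sval q u >].
have t0 : T by exact: (exist _ p' (conj p'sub (fun u _ => lexx _))).
(* a chain is bounded by its pointwise infimum, which is again sublinear *)
have [| |A Atot|q qmin] := @ZL_preorder T t0 ord.
- by move=> q; apply/asboolP.
- move=> q r s /asboolP qr /asboolP rs; apply/asboolP => u Du.
  exact: le_trans (rs _ Du) (qr _ Du).
- have [[q0 Aq0]|/forallNP A0] := pselect (exists q, A q); last first.
    by exists t0 => s /A0.
  pose m u := inf [set sval q u | q in A].
  have mle q u : A q -> D u -> m u <= sval q u.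
    move=> Aq Du; apply: ge_inf; last by exists q.
    exists (- p' (- u)) => _ [r Ar <-].
    have := subN _ _ (proj1 (svalP r)) Du.
    have := (proj2 (svalP r)) _ (DN _ Du); lra.
  have lbm u x : (forall q, A q -> x <= sval q u) -> x <= m u.
    move=> H; apply: lb_le_inf; first by exists (sval q0 u); exists q0.
    by move=> _ [q Aq <-]; exact: H.
  have msub : sublinear_on D m.
    split=> [u w Du Dw|a u Du].
      rewrite -lerBlDr; apply: (lbm) => q Aq; rewrite lerBlDr [leRHS]addrC -lerBlDr.
      apply: (lbm) => r Ar; rewrite lerBlDr.
      have [/asboolP H|/asboolP H] := Atot _ _ Aq Ar.
      + have := mle r _ Ar (Dadd Du Dw).
        have := (proj1 (svalP r)).1 _ _ Du Dw; have := H _ Du; lra.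
      + have := mle q _ Aq (Dadd Du Dw).
        have := (proj1 (svalP q)).1 _ _ Du Dw; have := H _ Dw; lra.
    have pos b w : D w -> 0 < b -> m (b *: w) <= b * m w.
      move=> Dw b0; rewrite -ler_pdivrMl//; apply: (lbm) => q Aq.
      rewrite ler_pdivrMl// -(proj1 (svalP q)).2//; last exact: ltW.
      by apply: (mle) => //; exact: Dscale.
    rewrite le_eqVlt => /predU1P[<-|a0].
      rewrite scale0r mul0r; apply/eqP; rewrite eq_le; apply/andP; split.
        have := mle q0 _ Aq0 (D0 Du).
        by rewrite (sublinear_on0 (proj1 (svalP q0)) Du).
      by apply: (lbm) => q Aq; rewrite (sublinear_on0 (proj1 (svalP q)) Du).
    apply/eqP; rewrite eq_le pos//=.
    have := pos a^-1 (a *: u) (Dscale a Du).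
    rewrite invr_gt0 => /(_ a0).
    by rewrite scalerA mulVf ?gt_eqF// scale1r ler_pdivlMl.
  have mle' u : D u -> m u <= p' u.
    by move=> Du; apply: le_trans (mle _ _ Aq0 Du) _; exact: (proj2 (svalP q0)).
  exists (exist _ m (conj msub mle')) => q Aq.
  by apply/asboolP => u Du; exact: mle.
have [qsub qp] := svalP q.
have qadd u w : D u -> D w -> sval q (u + w) = sval q u + sval q w.
  move=> Du Dw; apply/eqP; rewrite eq_le qsub.1//=.
  (* by minimality [q] lies below its tilt along [w], hence at [u] below
     [q (u + w) - q w] *)
  pose r := tilt (sval q) w (sval q w).
  have rsub : sublinear_on D r by exact: tilt_sublinear.
  have rq x : D x -> r x <= sval q x.
    move=> Dx; have := tilt_le qsub Dw (lexx _) Dx (lexx 0).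
    by rewrite scale0r addr0 mul0r subr0.
  have rp x : D x -> r x <= p' x.
    by move=> Dx; apply: le_trans (rq _ Dx) (qp _ Dx).
  have /asboolP := qmin (exist _ r (conj rsub rp)) (asboolT rq).
  move=> /(_ u Du)/=.
  have := tilt_le qsub Dw (lexx _) Du ler01.
  rewrite -/r scale1r mul1r; lra.
have qN u : D u -> sval q (- u) = - sval q u.
  move=> Du; have := qadd _ _ Du (DN _ Du).
  by rewrite subrr (sublinear_on0 qsub Du); lra.
exists (sval q); split => //.
- move=> a u Du; have [a0|a0] := leP 0 a; first exact: qsub.2.
  have := qsub.2 (- a) u Du; rewrite oppr_ge0 => /(_ (ltW a0)).
  by rewrite scaleNr (qN _ (Dscale a Du)); lra.
- by move=> u Du; apply: le_trans (qp _ Du) (p'le _ Du).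
- apply/eqP; rewrite eq_le; apply/andP; split.
    by apply: le_trans (qp _ Dv) (p'le _ Dv).
  have := tilt_le psub Dv (lexx _) (DN _ Dv) ler01.
  rewrite -/p' scale1r mul1r addNr (sublinear_on0 psub Dv).
  have := qp _ (DN _ Dv); rewrite qN//; lra.
Qed.

End HahnBanach.

(** * Positive functionals on bounded continuous functions are integrals *)

(** The decreasing piecewise linear function from 1 on the left of [a] to 0 on
    the right of [b]. *)
Definition ramp (R : realType) (a b x : R) : R :=
  Num.min 1 (Num.max 0 ((b - x) / (b - a))).

Record Cb_mean (R : realType) (L : (R -> R) -> R) : Prop := CbMean {
  mean_add : forall f g, Cb f -> Cb g -> L (fun x => f x + g x) = L f + L g;
  mean_scale : forall a f, Cb f -> L (fun x => a * f x) = a * L f;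
  mean_mono : forall f g, Cb f -> Cb g -> (forall x, f x <= g x) -> L f <= L g;
  mean_one : L (fun=> 1) = 1 }.

(** What is left, for the values at ramps, of [F] being the distribution function
    of [L].  The lower bound is required only for [a' < a]: this is immediate for
    an [F] that is defined as an infimum over ramps, and it is enough for comparing
    two functionals. *)
Definition has_cdf (R : realType) (F : R -> R) (L : (R -> R) -> R) : Prop :=
  forall a' a b, a' < a -> a < b -> F a' <= L (ramp a b) <= F b.

Section Ramp.
Context (R : realType).
Implicit Types a b x : R.

Lemma ramp_left a b x : a < b -> x <= a -> ramp a b x = 1.
Proof.
move=> ab xa; rewrite /ramp min_l// le_max; apply/orP; right.
by rewrite ler_pdivlMr ?subr_gt0// mul1r lerD2l lerN2.
Qed.

Lemma ramp_right a b x : a < b -> b <= x -> ramp a b x = 0.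
Proof.
move=> ab bx; rewrite /ramp max_l ?min_r//.
by rewrite ler_pdivrMr ?subr_gt0// mul0r subr_le0.
Qed.

Lemma ramp_ge0 a b x : 0 <= ramp a b x.
Proof. by rewrite /ramp le_min ler01 le_max lexx. Qed.

Lemma ramp_le1 a b x : ramp a b x <= 1.
Proof. by rewrite /ramp ge_min lexx. Qed.

Lemma bounded_lip_ramp a b : bounded_lip (@ramp R a b).
Proof.
split; last by apply: (bdd_itv (a := 0) (b := 1)) => x; rewrite ramp_ge0 ramp_le1.
apply: lip_min; first exact: lip_cst.
apply: lip_max; first exact: lip_cst.
apply: (lip_comp (lip_divr (b - a)) (g := fun x => b - x)).
by apply: lip_add; [exact: lip_cst|apply: lip_opp; exact: lip_id].
Qed.

Lemma ramp_Cb a b : Cb (@ramp R a b).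
Proof. exact: bounded_lip_Cb (bounded_lip_ramp a b). Qed.

End Ramp.

Section Mean.
Context (R : realType).
Implicit Types (f g : R -> R) (L : (R -> R) -> R).

Lemma mean_cst L c : Cb_mean L -> L (fun=> c) = c.
Proof.
move=> ML; have := mean_scale ML c (Cb_cst 1).
by rewrite (mean_one ML) mulr1 => {2}<-; congr L; apply/funext => x; rewrite mulr1.
Qed.

Lemma mean_affine L f c d : Cb_mean L -> Cb f ->
  L (fun x => c + d * f x) = c + d * L f.
Proof.
move=> ML Cf; rewrite (mean_add ML) ?(mean_cst _ ML) ?(mean_scale ML)//.
- exact: Cb_cst.
- exact: Cb_scale.
Qed.

(** Piecewise linear interpolation at points which are close to each other
    approximates a continuous function by linear combinations of ramps.  The
    values of two functionals at one ramp may differ by an increment of [F], but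
    the coefficients are small and the increments of [F] telescope. *)
Lemma interpolation L1 L2 (F f : R -> R) (a h e : R) (m : nat) :
  Cb_mean L1 -> Cb_mean L2 -> has_cdf F L1 -> has_cdf F L2 -> 0 < h ->
  (forall x, 0 <= F x) -> 0 <= e ->
  (forall x y, a <= x <= a + m%:R * h -> `|x - y| <= h -> `|f x - f y| <= e) ->
  exists g, [/\ Cb g,
    forall x, a <= x <= a + m%:R * h -> `|g x - f x| <= e,
    forall x, a + m%:R * h <= x -> g x = f (a + m%:R * h),
    forall x, x <= a -> g x = f a &
    `|L1 g - L2 g| <= e * (F (a + m%:R * h) + F (a + m%:R * h - h))].
Proof.
move=> M1 M2 F1 F2 h0 F0 e0; elim: m => [|m IH] osc.
  exists (fun=> f a); split.
  - exact: Cb_cst.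
  - move=> x; rewrite mul0r addr0 => ax; rewrite (_ : x = a) ?subrr ?normr0//.
    by apply/eqP; rewrite eq_le andbC.
  - by move=> x; rewrite mul0r addr0.
  - by [].
  - by rewrite !mean_cst// subrr normr0 mulr_ge0// addr_ge0.
set t := a + m%:R * h.
have tS : a + m.+1%:R * h = t + h by rewrite /t -addn1 natrD mulrDl mul1r addrA.
have at_ : a <= t by rewrite /t lerDl mulr_ge0// ltW.
have tt : t < t + h by rewrite ltrDl.
have [x y xt xy|g [Cg gf gr gl gL]] := IH.
  apply: osc => //; rewrite tS -/t; move: xt => /andP[-> /= /le_trans]; apply.
  exact: ltW.
pose d := f (t + h) - f t.
have de : `|d| <= e.
  rewrite /d distrC; apply: osc; first by rewrite tS at_ ltW.
  by rewrite opprD addNKr normrN gtr0_norm.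
exists (fun x => g x + (d + (- d) * ramp t (t + h) x)).
have Cr : Cb (fun x => d + (- d) * ramp t (t + h) x).
  by apply: Cb_add; [exact: Cb_cst|apply: Cb_scale; exact: ramp_Cb].
rewrite tS addrK; split.
- exact: Cb_add.
- move=> x /andP[ax xt]; have [xlt|tlx] := leP x t.
    by rewrite ramp_left// mulr1 subrr addr0 gf// ax.
  have e1 : `|f x - f t| <= e.
    apply: osc; first by rewrite ax tS.
    by rewrite gtr0_norm; lra.
  have e2 : `|f x - f (t + h)| <= e.
    apply: osc; first by rewrite ax tS.
    by rewrite ler0_norm; lra.
  rewrite gr; last exact: ltW.
  set r := ramp _ _ x.
  have r0 : 0 <= r := ramp_ge0 _ _ _.
  have r1 : r <= 1 := ramp_le1 _ _ _.
  have -> : f t + (d + - d * r) - f x =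
      - (r * (f x - f t) + (1 - r) * (f x - f (t + h))) by rewrite /d; ring.
  rewrite normrN; apply: le_trans (ler_normD _ _) _; rewrite !normrM.
  rewrite (ger0_norm r0) (ger0_norm (_ : 0 <= 1 - r)); last by lra.
  have := ler_wpM2l r0 e1; have : 0 <= 1 - r by lra.
  by move=> r1'; have := ler_wpM2l r1' e2; lra.
- move=> x tx; rewrite ramp_right// mulr0 addr0 gr.
    by rewrite /d addrC subrK.
  by apply: le_trans tx; exact: ltW.
- move=> x xa; rewrite ramp_left// ?mulr1 ?subrr ?addr0 ?gl//.
  exact: le_trans xa at_.
- rewrite (mean_add M1)// (mean_add M2)// !mean_affine//; try exact: ramp_Cb.
  set l1 := L1 (ramp _ _); set l2 := L2 (ramp _ _).
  have th : t - h < t by lra.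
  have /andP[f1 f2] : F (t - h) <= l1 <= F (t + h) by exact: F1.
  have /andP[f3 f4] : F (t - h) <= l2 <= F (t + h) by exact: F2.
  have -> : L1 g + (d + - d * l1) - (L2 g + (d + - d * l2)) =
    (L1 g - L2 g) - d * (l1 - l2) by ring.
  apply: le_trans (ler_normB _ _) _; rewrite normrM.
  have : `|d| * `|l1 - l2| <= e * (F (t + h) - F (t - h)).
    by apply: ler_pM => //; rewrite ler_norml; lra.
  by move: gL; rewrite -/t; lra.
Qed.

(** Two functions that are close on a large interval and bounded outside have close
    means, when the mean of the part outside is small. *)
Lemma mean_approx L f g (c B : R) K : Cb_mean L -> Cb f -> Cb g ->
  (forall x, `|g x - f x| <= c + B * (1 + ramp (- K - 1) (- K) x - ramp K (K + 1) x)) ->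
  `|L g - L f| <= c + B * (1 + L (ramp (- K - 1) (- K)) - L (ramp K (K + 1))).
Proof.
move=> ML Cf Cg gf; set r1 := ramp (- K - 1) _ in gf *.
set r2 := ramp K _ in gf *.
have C1 : Cb r1 by exact: ramp_Cb.
have C2 : Cb r2 by exact: ramp_Cb.
pose k x := (c + B) + (B * r1 x + - B * r2 x).
have Ck : Cb k.
  by apply: Cb_add; [exact: Cb_cst|apply: Cb_add; exact: Cb_scale].
have Lk : L k = c + B * (1 + L r1 - L r2).
  rewrite (mean_add ML) ?(mean_cst _ ML) ?(mean_add ML) ?(mean_scale ML)//; last first.
  - by apply: Cb_add; exact: Cb_scale.
  - exact: Cb_cst.
  - exact: Cb_scale.
  - exact: Cb_scale.
  by ring.
rewrite -Lk ler_norml; apply/andP; split.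
  rewrite lerBrDr addrC lerBlDr -(mean_add ML)//.
  apply: (mean_mono ML) => //; first exact: Cb_add.
  by move=> x; have := gf x; rewrite ler_norml /k => /andP[+ _]; lra.
rewrite lerBlDr -(mean_add ML)//.
apply: (mean_mono ML) => //; first exact: Cb_add.
by move=> x; have := gf x; rewrite ler_norml /k => /andP[_ +]; lra.
Qed.

(** Interpolate [f] on a large interval on which it is uniformly continuous. *)
Lemma mean_unique L1 L2 (F : R -> R) : Cb_mean L1 -> Cb_mean L2 ->
  has_cdf F L1 -> has_cdf F L2 -> (forall x, 0 <= F x <= 1) ->
  {homo F : x y / x <= y} ->
  (forall e, 0 < e -> exists K, F (- K) <= e /\ 1 - e <= F K) ->
  forall f, Cb f -> L1 f = L2 f.
Proof.
move=> M1 M2 F1 F2 F01 Fnd Ftail f Cf.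
suff H e : 0 < e -> `|L1 f - L2 f| <= e.
  apply/eqP; rewrite -subr_eq0 -normr_le0; apply/ler_addgt0Pl => e e0.
  by rewrite addr0; exact: H.
move=> e0; have /CbP[cf [B0 fB0]] := Cf.
pose B := Num.max B0 1.
have B1 : 1 <= B by rewrite /B le_max lexx orbT.
have fB x : `|f x| <= B by rewrite /B le_max fB0.
have [|K0 [FK1 FK2]] := Ftail (e / (16 * B)).
  by rewrite divr_gt0//; lra.
pose K := Num.max K0 1.
have K1 : 1 <= K by rewrite /K le_max lexx orbT.
have K0K : K0 <= K by rewrite /K le_max lexx.
have {}FK1 : F (- K) <= e / (16 * B).
  by apply: le_trans (Fnd _ _ _) FK1; rewrite lerN2.
have {}FK2 : 1 - e / (16 * B) <= F K by apply: le_trans FK2 (Fnd _ _ _).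
have e80 : 0 < e / 8 by lra.
have [d d0 fd] := @heine R f (- (K + 2)) (K + 2) _ cf e80.
have Kd0 : 0 <= 2 * (K + 2) / d by rewrite divr_ge0//; lra.
pose N := Num.bound (2 * (K + 2) / d).
have hN : 2 * (K + 2) / d < N%:R by apply: archi_boundP.
have N0 : 0 < N%:R :> R by exact: le_lt_trans hN.
pose h := 2 * (K + 2) / N%:R.
have h0 : 0 < h by rewrite divr_gt0//; lra.
have hd : h < d by rewrite ltr_pdivrMr// [ltRHS]mulrC -ltr_pdivrMr.
have Nh : - (K + 2) + N%:R * h = K + 2.
  by rewrite /h [N%:R * _]mulrC divfK ?gt_eqF//; ring.
have [x||x y|g [Cg gf gr gl gL]] :=
    @interpolation L1 L2 F f (- (K + 2)) h (e / 8) N M1 M2 F1 F2 h0.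
- by have /andP[] := F01 x.
- by lra.
- rewrite Nh => xK xy; apply/ltW/fd => //; exact: le_lt_trans xy hd.
rewrite Nh in gf gr gL.
have gK x : `|g x - f x| <=
    e / 8 + 2 * B * (1 + ramp (- (K + 1) - 1) (- (K + 1)) x
                     - ramp (K + 1) (K + 1 + 1) x).
  have r1 : 0 <= ramp (- (K + 1) - 1) (- (K + 1)) x := ramp_ge0 _ _ _.
  have r2 : ramp (K + 1) (K + 1 + 1) x <= 1 := ramp_le1 _ _ _.
  have r0 : 0 <= 2 * B * (1 + ramp (- (K + 1) - 1) (- (K + 1)) x
                     - ramp (K + 1) (K + 1 + 1) x).
    by apply: mulr_ge0; lra.
  have [xl|lx] := leP x (- (K + 2)).
    rewrite gl// ramp_left; [|lra|lra]; rewrite ramp_left; [|lra|lra].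
    have := ler_normB (f (- (K + 2))) (f x).
    have := fB (- (K + 2)); have := fB x; lra.
  have [rx|xr] := leP (K + 2) x.
    rewrite gr// ramp_right; [|lra|lra]; rewrite ramp_right; [|lra|lra].
    have := ler_normB (f (K + 2)) (f x).
    have := fB (K + 2); have := fB x; lra.
  by have := gf x; rewrite (ltW lx) (ltW xr) => /(_ isT); lra.
have tail L : Cb_mean L -> has_cdf F L -> `|L g - L f| <= e / 8 + e / 4.
  move=> ML FL; apply: le_trans (mean_approx ML Cf Cg gK) _; rewrite lerD2l.
  have /andP[_ l1] : F (- (K + 1) - 2) <= L (ramp (- (K + 1) - 1) (- (K + 1))) <=
    F (- (K + 1)) by apply: FL; lra.
  have /andP[l2 _] : F K <= L (ramp (K + 1) (K + 1 + 1)) <= F (K + 1 + 1).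
    by apply: FL; lra.
  have l3 : F (- (K + 1)) <= F (- K) by apply: Fnd; lra.
  have -> : e / 4 = 2 * B * (2 * (e / (16 * B))) by field; lra.
  by rewrite ler_wpM2l//; lra.
have := tail _ M1 F1; have := tail _ M2 F2.
have : e / 8 * (F (K + 2) + F (K + 2 - h)) <= e / 8 * 2.
  rewrite ler_wpM2l//; first by lra.
  by have /andP[_ ?] := F01 (K + 2); have /andP[_ ?] := F01 (K + 2 - h); lra.
move: gL; rewrite !ler_norml => /andP[+ +] + /andP[+ +] /andP[+ +]; lra.
Qed.

End Mean.

Section Riesz.
Context (R : realType).
Implicit Types (f g : R -> R) (L : (R -> R) -> R).

Lemma real_prob_setT (mu : real_prob R) : mu setT = 1%E.
Proof. exact: probability_setT. Qed.

Lemma Cb_integrable (mu : real_prob R) f : Cb f ->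
  mu.-integrable setT (EFin \o f).
Proof.
move=> [cf bf]; apply: measurable_bounded_integrable => //.
- by rewrite -ge0_fin_numE ?fin_num_measure.
- exact: continuous_measurable_fun.
Qed.

Lemma Rintegral_mean (mu : real_prob R) :
  Cb_mean (fun f => \int[mu]_x f x).
Proof.
split=> [f g Cf Cg|a f Cf|f g Cf Cg fg|].
- by rewrite RintegralD//; exact: Cb_integrable.
- by rewrite RintegralZl//; exact: Cb_integrable.
- by apply: le_Rintegral => //; exact: Cb_integrable.
- rewrite Rintegral_cst// mul1r.
  exact: (congr1 fine (real_prob_setT mu)).
Qed.

Lemma Rintegral_has_cdf (mu : real_prob R) (F : R -> R) :
  (forall x, mu `]-oo, x]%classic = (F x)%:E) -> {homo F : x y / x <= y} ->
  has_cdf F (fun f => \int[mu]_x f x).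
Proof.
move=> muF Fnd a' a b a'a ab.
have FE x : F x = \int[mu]_y \1_(`]-oo, x]%classic) y.
  rewrite /Rintegral.
  have -> : (\int[mu]_y (\1_(`]-oo, x]%classic) y)%:E = mu `]-oo, x]%classic)%E.
    by rewrite integral_indic// setIT.
  by rewrite muF.
have int1 x : mu.-integrable setT (EFin \o (\1_(`]-oo, x]%classic) : R -> R)).
  apply: measurable_bounded_integrable => //.
  - by rewrite -ge0_fin_numE ?fin_num_measure.
  - apply/bddP; apply: (bdd_itv (a := 0) (b := 1)) => y.
    by rewrite indicE; case: (_ \in _); rewrite /= ?lexx ler01.
have Cr := Cb_integrable mu (ramp_Cb a b).
apply/andP; split.
  apply: le_trans (Fnd _ _ (ltW a'a)) _; rewrite FE.
  apply: le_Rintegral => // x _; rewrite indicE.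
  case: (boolP (x \in `]-oo, a]%classic)) => /= [|_].
    by rewrite inE/= in_itv/= => xa; have -> : ramp a b x = 1 by exact: ramp_left.
  exact: ramp_ge0.
rewrite FE; apply: le_Rintegral => // x _; rewrite indicE.
have [bx|xb] := leP b x; first by have -> : ramp a b x = 0 by exact: ramp_right.
by rewrite mem_set /= ?ramp_le1// in_itv/= ltW.
Qed.

(** Starting the ramps strictly to the right of [x] makes this function
    right-continuous. *)
Definition mean_cdf L (x : R) : R :=
  inf [set L (ramp ab.1 ab.2) | ab in [set ab | x < ab.1 < ab.2]].

Section MeanCdf.
Variable L : (R -> R) -> R.
Hypothesis ML : Cb_mean L.

Let L01 a b : 0 <= L (ramp a b) <= 1.
Proof.
rewrite -{1}(mean_cst 0 ML) -(mean_one ML).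
by apply/andP; split; apply: (mean_mono ML); do ?[exact: ramp_Cb|exact: Cb_cst];
  move=> x; rewrite ?ramp_ge0 ?ramp_le1.
Qed.

Lemma mean_cdf_le x a b : x < a -> a < b -> mean_cdf L x <= L (ramp a b).
Proof.
move=> xa ab; apply: ge_inf; last by exists (a, b) => //=; rewrite xa.
by exists 0 => _ [[c d] _ <-]; have /andP[] := L01 c d.
Qed.

Lemma le_mean_cdf x y : (forall a b, x < a -> a < b -> y <= L (ramp a b)) ->
  y <= mean_cdf L x.
Proof.
move=> H; apply: lb_le_inf.
  by exists (L (ramp (x + 1) (x + 2))); exists (x + 1, x + 2) => //=; lra.
by move=> _ [[a b] /= /andP[xa ab] <-]; exact: H.
Qed.

Lemma mean_cdf_nondecreasing : {homo mean_cdf L : x y / x <= y}.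
Proof.
move=> x y xy; apply: le_mean_cdf => a b ya ab.
by apply: mean_cdf_le => //; exact: le_lt_trans ya.
Qed.

Lemma mean_cdf01 x : 0 <= mean_cdf L x <= 1.
Proof.
apply/andP; split.
  by apply: le_mean_cdf => a b _ _; have /andP[] := L01 a b.
apply: le_trans (mean_cdf_le (a := x + 1) (b := x + 2) _ _) _; [lra|lra|].
by have /andP[] := L01 (x + 1) (x + 2).
Qed.

Lemma mean_has_cdf : has_cdf (mean_cdf L) L.
Proof.
move=> a' a b a'a ab; rewrite mean_cdf_le//=.
apply: le_mean_cdf => c d bc cd.
apply: (mean_mono ML); [exact: ramp_Cb|exact: ramp_Cb|] => x.
have [xb|bx] := leP x b; last by rewrite ramp_right ?ramp_ge0// ltW.
by rewrite [leRHS]ramp_left ?ramp_le1//; lra.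
Qed.

Lemma mean_cdf_right_continuous : right_continuous (mean_cdf L).
Proof.
move=> x; apply/cvgrPdist_le => /= e e0.
have Sinf : has_inf [set L (ramp ab.1 ab.2) | ab in [set ab | x < ab.1 < ab.2]].
  split; first by exists (L (ramp (x + 1) (x + 2))); exists (x + 1, x + 2) => //=; lra.
  by exists 0 => _ [[c d] _ <-]; have /andP[] := L01 c d.
have [_ [[a b] /= /andP[xa ab] <-] Lab] := inf_adherent e0 Sinf.
near=> y; rewrite distrC ger0_norm ?subr_ge0; last first.
  by apply: mean_cdf_nondecreasing; near: y; exact: nbhs_right_ge.
have ya : y < a by near: y; exact: nbhs_right_lt.
have := mean_cdf_le ya ab; move: Lab; rewrite -/(mean_cdf L x); lra.
Unshelve. all: by end_near. Qed.

End MeanCdf.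

(** The Lebesgue-Stieltjes measure of the distribution function of [L] gives a
    second functional with the same distribution function, and a mean is determined
    by its distribution function.  The hypothesis is tightness. *)
Lemma riesz L : Cb_mean L ->
  (forall e, 0 < e -> exists K, L (ramp (- K - 1) (- K)) <= e /\
                                1 - e <= L (ramp K (K + 1))) ->
  exists mu : real_prob R, forall f, Cb f -> L f = \int[mu]_x f x.
Proof.
move=> ML Ltail; set F := mean_cdf L.
have Fnd : {homo F : x y / x <= y} by exact: mean_cdf_nondecreasing.
have F01 x : 0 <= F x <= 1 by exact: mean_cdf01.
have Ftail e : 0 < e -> exists K, F (- K) <= e /\ 1 - e <= F K.
  move=> /Ltail[K [K1 K2]]; exists (K + 2); split.
    by apply: le_trans K1; apply: mean_cdf_le => //; lra.
  have /andP[_] : F (K - 1) <= L (ramp K (K + 1)) <= F (K + 1).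
    by apply: mean_has_cdf => //; lra.
  have : F (K + 1) <= F (K + 2) by apply: Fnd; lra.
  lra.
have FNy : F @ -oo --> (0 : R).
  apply/cvgrPdist_le => e /Ftail[K [K1 K2]]; near=> x.
  rewrite sub0r normrN ger0_norm; last by have /andP[] := F01 x.
  by apply: le_trans K1; apply: Fnd; near: x; apply: nbhs_ninfty_le; exact: num_real.
have Fy : F @ +oo --> (1 : R).
  apply/cvgrPdist_le => e /Ftail[K [K1 K2]]; near=> x.
  rewrite ger0_norm; last by have /andP[] := F01 x; lra.
  have : F K <= F x by apply: Fnd; near: x; apply: nbhs_pinfty_ge; exact: num_real.
  lra.
pose mcum := isCumulative.Build R _ R F Fnd (mean_cdf_right_continuous ML).
pose mbdd := isCumulativeBounded.Build R 0 1 F FNy Fy.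
pose G : cumulativeBounded 0 1 := HB.pack F mcum mbdd.
pose mu : real_prob R := lebesgue_stieltjes_measure G.
exists mu => f Cf.
have muF x : mu `]-oo, x]%classic = (F x)%:E.
  by have := cdf_lebesgue_stieltjes_id G x; rewrite /cdf/= preimage_id.
apply: (mean_unique ML (Rintegral_mean mu) (mean_has_cdf ML) _ F01 Fnd Ftail Cf).
exact: Rintegral_has_cdf.
Unshelve. all: by end_near. Qed.

End Riesz.

(** * The set of laws of a sublinear distribution *)

(** The functional induced on test functions by a random variable under a
    sublinear expectation; tightness is what the integrability of the random
    variable contributes. *)
Record sublinear_law (R : realType) (Lam : (R -> R) -> R) : Prop :=
  SublinearLaw {
    law_mono : forall f g, bounded_lip f -> bounded_lip g ->
      (forall x, f x <= g x) -> Lam f <= Lam g;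
    law_cst : forall c, Lam (fun=> c) = c;
    law_subadd : forall f g, bounded_lip f -> bounded_lip g ->
      Lam (fun x => f x + g x) <= Lam f + Lam g;
    law_poshom : forall a f, bounded_lip f -> 0 <= a ->
      Lam (fun x => a * f x) = a * Lam f;
    law_tight : forall e, 0 < e -> exists K,
      Lam (fun x => 1 + (ramp (- K - 1) (- K) x - ramp K (K + 1) x)) <= e }.

Definition dominated_probs (R : realType) (Lam : (R -> R) -> R) :
    set (real_prob R) :=
  [set mu : real_prob R | forall f, bounded_lip f -> \int[mu]_x f x <= Lam f].

Section Law.
Context (R : realType) (Lam : (R -> R) -> R).
Hypothesis HL : sublinear_law Lam.
Implicit Types f g : R -> R.

(** A mean dominated by [Lam] inherits its tightness. *)
Lemma dominated_mean_integral (L : (R -> R) -> R) : Cb_mean L ->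
  (forall f, bounded_lip f -> L f <= Lam f) ->
  exists2 mu, dominated_probs Lam mu & forall f, Cb f -> L f = \int[mu]_x f x.
Proof.
move=> ML LLam; have [|mu Lmu] := riesz ML.
  move=> e e0; have [K HK] := law_tight HL e0; exists K.
  set r1 := ramp (- K - 1) (- K) in HK *; set r2 := ramp K (K + 1) in HK *.
  have C1 : Cb r1 by exact: ramp_Cb.
  have C2 : Cb r2 by exact: ramp_Cb.
  have : L (fun x => 1 + (r1 x + (- 1) * r2 x)) <= e.
    apply: le_trans HK; rewrite (_ : (fun x => 1 + (r1 x + _)) =
      (fun x => 1 + (r1 x - r2 x))); last first.
      by apply/funext => x; rewrite mulN1r.
    apply: LLam; apply: bounded_lip_add; first exact: bounded_lip_cst.
    apply: bounded_lip_add; first exact: bounded_lip_ramp.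
    apply: bounded_lip_opp; exact: bounded_lip_ramp.
  have C3 : Cb (fun x => (- 1) * r2 x) by exact: Cb_scale.
  rewrite (mean_add ML) ?(mean_add ML) ?(mean_scale ML) ?(mean_one ML)//; last 2 first.
  - exact: Cb_cst.
  - exact: Cb_add.
  have : 0 <= L r1.
    rewrite -(mean_cst 0 ML); apply: (mean_mono ML) => //; first exact: Cb_cst.
    by move=> x; exact: ramp_ge0.
  have : L r2 <= 1.
    rewrite -(mean_one ML); apply: (mean_mono ML) => //; first exact: Cb_cst.
    by move=> x; exact: ramp_le1.
  by move=> l1 l2 l3; split; lra.
exists mu => // f bf; rewrite -Lmu; [exact: LLam|exact: bounded_lip_Cb].
Qed.

(** The extension of [Lam] to bounded functions by approximation from above. *)
Let upper (f : R -> R^o) : R :=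
  inf [set Lam g | g in [set g | bounded_lip g /\ forall x, f x <= g x]].

Let upper_le f g : bdd f -> bounded_lip g -> (forall x, f x <= g x) ->
  upper f <= Lam g.
Proof.
move=> [B fB] bg fg; apply: ge_inf; last by exists g.
exists (- B) => _ [h [bh fh] <-]; rewrite -(law_cst HL (- B)).
apply: (law_mono HL) => //; first exact: bounded_lip_cst.
move=> x; apply: le_trans (fh x).
by have := fB x; rewrite ler_norml => /andP[].
Qed.

Let le_upper f y : bdd f ->
  (forall g, bounded_lip g -> (forall x, f x <= g x) -> y <= Lam g) ->
  y <= upper f.
Proof.
move=> [B fB] H; apply: lb_le_inf; last by move=> _ [g [bg fg] <-]; exact: H.
exists (Lam (fun=> B)); exists (fun=> B) => //; split; first exact: bounded_lip_cst.
by move=> x; apply: le_trans (fB x); exact: ler_norm.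
Qed.

Let upperE f : bounded_lip f -> upper f = Lam f.
Proof.
move=> bf; have bdf : bdd f by case: bf.
apply/eqP; rewrite eq_le upper_le//=.
by apply: le_upper => // g bg fg; exact: (law_mono HL).
Qed.

Let upper_sublinear : sublinear_on (@bdd R : set (R -> R^o)) upper.
Proof.
split=> [f g bf bg|a f bf].
  rewrite -lerBlDr; apply: (le_upper bf) => h bh fh.
  rewrite lerBlDr [leRHS]addrC -lerBlDr.
  apply: (le_upper bg) => k bk gk; rewrite lerBlDr.
  apply: le_trans (upper_le _ (bounded_lip_add bk bh) _) _.
  - exact: bdd_add.
  - by move=> x; rewrite [leRHS]addrC; exact: lerD.
  - exact: (law_subadd HL).
have pos b g : bdd g -> 0 < b -> upper (b *: (g : R -> R^o)) <= b * upper g.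
  move=> bg b0; rewrite -ler_pdivrMl//; apply: (le_upper bg) => h bh gh.
  rewrite ler_pdivrMl// -(law_poshom HL)//; last exact: ltW.
  apply: upper_le; [exact: bdd_scale|exact: bounded_lip_scale|].
  by move=> x; rewrite ler_wpM2l// ltW.
rewrite le_eqVlt => /predU1P[<-|a0].
  rewrite scale0r mul0r upperE; first exact: (law_cst HL).
  exact: bounded_lip_cst.
apply/eqP; rewrite eq_le pos//=.
have := pos a^-1 (a *: (f : R -> R^o)) (bdd_scale a bf).
rewrite invr_gt0 => /(_ a0).
by rewrite scalerA mulVf ?gt_eqF// scale1r ler_pdivlMl.
Qed.

(** Hahn-Banach on all bounded functions gives a linear functional below [upper]
    that agrees with it at [f]; domination makes it positive and normalised. *)
Lemma law_attained f : bounded_lip f ->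
  exists2 mu, dominated_probs Lam mu & Lam f = \int[mu]_x f x.
Proof.
move=> bf.
have bddlin a (u v : R -> R^o) : bdd u -> bdd v -> bdd (a *: u + v).
  by move=> bu bv; apply: bdd_add => //; exact: bdd_scale.
have bdf : bdd f by case: bf.
have [L [LD LZ Lup Lf]] := hahn_banach bddlin upper_sublinear bdf.
have Cbdd g : Cb g -> bdd g by move=> /CbP[].
have LLam g : bounded_lip g -> L g <= Lam g.
  by move=> bg; rewrite -upperE//; apply: Lup; case: bg.
have Lmono g h : bdd g -> bdd h -> (forall x, g x <= h x) -> L g <= L h.
  move=> bg bh gh; have bhN := bdd_scale (- 1) bh.
  have : L ((g : R -> R^o) + (fun x => - 1 * h x)) <= 0.
    apply: le_trans (Lup _ (bdd_add bg bhN)) _.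
    rewrite -(law_cst HL 0); apply: upper_le => //.
    - exact: bdd_add.
    - exact: bounded_lip_cst.
    - by move=> x /=; rewrite mulN1r subr_le0.
  by rewrite LD// [X in _ + X](LZ (- 1) h)// mulN1r subr_le0.
have Lone : L (fun=> 1) = 1.
  apply/eqP; rewrite eq_le; apply/andP; split.
    by rewrite -[leRHS](law_cst HL 1); apply: LLam; exact: bounded_lip_cst.
  rewrite -lerN2 -[leLHS]mulN1r -LZ; last exact: bdd_cst.
  rewrite -[leRHS](law_cst HL (- 1)).
  rewrite (_ : - 1 *: _ = fun=> - 1); last by apply/funext => x; exact: mulr1.
  by apply: LLam; exact: bounded_lip_cst.
have [|mu muP Lmu] := dominated_mean_integral (L := L) _ LLam.
  split=> //.
  - by move=> g h /Cbdd bg /Cbdd bh; exact: LD.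
  - by move=> a g /Cbdd bg; exact: LZ.
  - by move=> g h /Cbdd bg /Cbdd bh; exact: Lmono.
exists mu => //; rewrite -Lmu ?Lf ?upperE//; exact: bounded_lip_Cb.
Qed.

Lemma law_represented f : bounded_lip f ->
  Lam f = sup [set \int[mu]_x f x | mu in dominated_probs Lam].
Proof.
move=> bf; have [mu muP Lmu] := law_attained bf.
apply/eqP; rewrite eq_le; apply/andP; split.
  rewrite Lmu; apply: ub_le_sup; last by exists mu.
  by exists (Lam f) => _ [nu nuP <-]; exact: nuP.
apply: ge_sup; first by exists (\int[mu]_x f x); exists mu.
by move=> _ [nu nuP <-]; exact: nuP.
Qed.

(** For nonnegative functions this is additivity of the integral in the measure;
    a bounded function becomes nonnegative after adding a constant. *)
Lemma Rintegral_mixture (mu nu rho : real_prob R) (t : R) f : 0 <= t <= 1 ->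
  (forall A : set (measurableTypeR R), measurable A ->
     rho A = (t%:E * mu A + (1 - t)%:E * nu A)%E) -> Cb f ->
  \int[rho]_x f x = t * (\int[mu]_x f x) + (1 - t) * (\int[nu]_x f x).
Proof.
move=> /andP[t0 t1] rhoE Cf.
have t1' : 0 <= 1 - t by rewrite subr_ge0.
have mix0 g : Cb g -> (forall x, 0 <= g x) ->
    \int[rho]_x g x = t * (\int[mu]_x g x) + (1 - t) * (\int[nu]_x g x).
  move=> Cg g0.
  have mg : measurable_fun setT (EFin \o g : measurableTypeR R -> \bar R).
    by apply/measurable_EFinP; apply: continuous_measurable_fun; case: Cg.
  apply: EFin_inj; rewrite EFinD !EFinM /Rintegral.
  rewrite !fineK; do ?by apply: integrable_fin_num => //; exact: Cb_integrable.
  rewrite (eq_measure_integral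
    (measure_add (mscale (NngNum t0) mu) (mscale (NngNum t1') nu))); last first.
    by move=> A mA _; rewrite [RHS]measure_addE; exact: rhoE.
  rewrite ge0_integral_measure_add//; last by move=> x _; rewrite /= lee_fin.
  by rewrite !ge0_integral_mscale//= => x _; rewrite lee_fin.
have /CbP[_ [B fB]] := Cf.
have Mr := Rintegral_mean rho; have Mm := Rintegral_mean mu.
have Mn := Rintegral_mean nu.
have := mix0 (fun x => B + 1 * f x).
rewrite (mean_affine _ _ Mr)// (mean_affine _ _ Mm)// (mean_affine _ _ Mn)//.
rewrite !mul1r => H.
have /H{H} : Cb (fun x => B + 1 * f x).
  by apply: Cb_add; [exact: Cb_cst|exact: Cb_scale].
have B0 x : 0 <= B + 1 * f x.
  by have := fB x; rewrite ler_norml => /andP[]; lra.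
by move=> /(_ B0); lra.
Qed.

Lemma dominated_probs_convex : convex_prob_set (dominated_probs Lam).
Proof.
move=> mu nu rho t muP nuP t01 rhoE f bf.
rewrite (Rintegral_mixture t01 rhoE); last exact: bounded_lip_Cb.
have /andP[t0 t1] := t01.
have := ler_wpM2l t0 (muP _ bf).
have : 0 <= 1 - t by rewrite subr_ge0.
by move=> /(@ler_wpM2l _)/(_ _ _ (nuP _ bf)); lra.
Qed.

(** Along an ultrafilter the integrals of each test function converge; the
    limits form a mean dominated by [Lam], hence the integrals for some
    probability. *)
Lemma dominated_probs_compact : weakly_compact (dominated_probs Lam).
Proof.
rewrite /weakly_compact compact_ultra => F UF FP.
have PF : ProperFilter F by exact: ultra_proper.
pose I f (mu : real_prob R) : R := \int[mu]_x f x.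
have Icvg f : Cb f -> exists l : R, I f @ F --> l.
  move=> Cf; have /CbP[_ [B fB]] := Cf.
  have [|l [_ lcl]] := @segment_compact R (- B) B (I f @ F) _.
    apply: (@filterE _ F) => mu; rewrite /= in_itv/=; have Mm := Rintegral_mean mu.
    apply/andP; split.
      rewrite -(mean_cst (- B) Mm); apply: (mean_mono Mm) => //; first exact: Cb_cst.
      by move=> x; have := fB x; rewrite ler_norml => /andP[].
    rewrite -(mean_cst B Mm); apply: (mean_mono Mm) => //; first exact: Cb_cst.
    by move=> x; have := fB x; rewrite ler_norml => /andP[].
  (* a cluster point of an ultrafilter is its limit *)
  exists l => A lA; have [//|FnA] := in_ultra_setVsetC (I f @^-1` A) UF.
  by have [y []] := lcl (~` A) A FnA lA.
pose L f : R := lim (I f @ F).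
have IL f : Cb f -> I f @ F --> L f.
  by move=> /Icvg[l Il]; rewrite /L (cvg_lim _ Il)//; exact: Rhausdorff.
have ML : Cb_mean L.
  split=> [f g Cf Cg|a f Cf|f g Cf Cg fg|].
  - apply: cvg_lim; first exact: Rhausdorff.
    rewrite (_ : I _ = fun mu => I f mu + I g mu); last first.
      by apply/funext => mu; rewrite /I (mean_add (Rintegral_mean mu)).
    by apply: cvgD; exact: IL.
  - apply: cvg_lim; first exact: Rhausdorff.
    rewrite (_ : I _ = fun mu => a * I f mu); last first.
      by apply/funext => mu; rewrite /I (mean_scale (Rintegral_mean mu)).
    by apply: cvgM; [exact: cvg_cst|exact: IL].
  - apply: (ler_cvg_to (IL _ Cf) (IL _ Cg)); apply: filterE => mu.
    exact: (mean_mono (Rintegral_mean mu)).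
  - apply: cvg_lim; first exact: Rhausdorff.
    rewrite (_ : I _ = fun=> 1); first exact: cvg_cst.
    by apply/funext => mu; exact: (mean_one (Rintegral_mean mu)).
have LLam f : bounded_lip f -> L f <= Lam f.
  move=> bf; apply: (ler_cvg_to (IL _ (bounded_lip_Cb bf)) (cvg_cst (Lam f))).
  by apply: filterS FP => mu; exact.
have [mu muP Lmu] := dominated_mean_integral ML LLam.
exists mu; split => // A [_ [[B Bop <-] Bmu sBA]].
have : {ptws, @weak_embedding R @ F --> @weak_embedding R mu}.
  apply/cvg_sup => -[f Cf] D [_ [[C Cop <-] Cmu sCD]].
  have Cf' : Cb f by move: (Cf); rewrite inE.
  apply: filterS sCD _; apply: (IL _ Cf' C); rewrite Lmu//.
  exact: open_nbhs_nbhs.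
move=> /(_ B) FB; apply: filterS sBA _; apply: FB.
exact: open_nbhs_nbhs.
Qed.

End Law.

(** * Expectations of test functions of a random variable *)

Lemma coord_le_norm (R : realType) (n : nat) (v : 'rV[R]_n) i :
  `|v ord0 i| <= `|v|.
Proof.
rewrite (_ : `|v| = mx_norm v)// mx_normrE.
exact: (le_bigmax _ (fun ij => `|v ij.1 ij.2|) (ord0, i)).
Qed.

(** This form of test function serves both for the stability of [H] under functions
    of sums and for independence. *)
Lemma CbLip_sum (R : realType) (n : nat) (f h : R -> R) (s : R) :
  bounded_lip f -> lip h ->
  CbLip (fun v : 'rV[R]_n => f (s + \sum_i h (v ord0 i))).
Proof.
move=> [/lip_posk[k k0 fk] [B fB]] /lip_posk[l l0 hl]; split; last first.
  exists B; split=> [|x Bx y _ /=]; first exact: num_real.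
  exact: le_trans (fB _) (ltW Bx).
exists (k * (l * n%:R)); split=> [|m km [v w] _ /=]; first exact: num_real.
apply: le_trans (fk _ _) _; rewrite opprD addrACA subrr add0r -sumrB.
apply: (@le_trans _ _ (k * (l * n%:R) * `|v - w|)); last first.
  by rewrite ler_wpM2r// ltW.
rewrite -mulrA ler_wpM2l//; first exact: ltW.
apply: le_trans (ler_norm_sum _ _ _) _.
have -> : l * n%:R * `|v - w| = \sum_(i < n) l * `|v - w|.
  by rewrite sumr_const card_ord -mulr_natr; ring.
rewrite ler_sum// => i _; apply: le_trans (hl _ _) _.
rewrite ler_wpM2l//; first exact: ltW.
by have := coord_le_norm (v - w) i; rewrite !mxE.
Qed.

Section RandomVariables.
Context (R : realType) (Omega : Type) (H : set (Omega -> R))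
  (E : (Omega -> R) -> R).
Hypotheses (hH : rv_space H) (hE : sublinear_expectation H E).
Implicit Types (X Y : Omega -> R) (f g h : R -> R).

Lemma H_opp X : H X -> H (fun w => - X w).
Proof.
move=> /(rv_scale hH (- 1)); congr (H _).
by apply/funext => w; rewrite mulN1r.
Qed.

Lemma H_addc X c : H X -> H (fun w => X w + c).
Proof. by move=> HX; apply: (rv_add hH) => //; exact: (rv_cst hH). Qed.

Lemma H_sum (X : nat -> Omega -> R) n : (forall i, H (X i)) ->
  H (fun w => \sum_(i < n) X i w).
Proof.
move=> HX; elim: n => [|n IH].
  rewrite (_ : (fun w => _) = fun=> 0); first exact: (rv_cst hH).
  by apply/funext => w; rewrite big_ord0.
rewrite (_ : (fun w => _) = fun w => \sum_(i < n) X i w + X n w).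
  exact: (rv_add hH).
by apply/funext => w; rewrite big_ord_recr.
Qed.

Lemma H_comp_sum (X : nat -> Omega -> R) n f h s : (forall i, H (X i)) ->
  bounded_lip f -> lip h -> H (fun w => f (s + \sum_(i < n) h (X i w))).
Proof.
move=> HX bf lh; case: n => [|n].
  rewrite (_ : (fun w => _) = fun=> f s); first exact: (rv_cst hH).
  by apply/funext => w; rewrite big_ord0 addr0.
have := rv_comp hH (X := fun i : 'I_n.+1 => X i) (fun i => HX i)
  (CbLip_sum n.+1 s bf lh).
congr (H _); apply/funext => w; congr (f (s + _)).
by apply: eq_bigr => i _; rewrite mxE.
Qed.

Lemma H_comp X f : H X -> bounded_lip f -> H (fun w => f (X w)).
Proof.
move=> HX bf.
have := H_comp_sum 1 0 (X := fun=> X) (fun=> HX) bf (lip_id R).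
by congr (H _); apply/funext => w; rewrite big_ord1 add0r.
Qed.

Lemma E_addc X c : H X -> E (fun w => X w + c) = E X + c.
Proof.
move=> HX; apply/eqP; rewrite eq_le; apply/andP; split.
  by rewrite -{2}(sle_cst hE c); apply: (sle_subadditive hE) => //; exact: (rv_cst hH).
have := sle_subadditive hE (H_addc c HX) (rv_cst hH (- c)).
rewrite (sle_cst hE) (_ : (fun w => _) = X); first by lra.
by apply/funext => w; rewrite addrK.
Qed.

Lemma E_leD X Y Z : H X -> H Y -> H Z -> (forall w, X w <= Y w + Z w) ->
  E X <= E Y + E Z.
Proof.
move=> HX HY HZ XYZ; apply: le_trans (sle_subadditive hE HY HZ).
by apply: (sle_monotone hE) => //; exact: (rv_add hH).
Qed.

Lemma E_le_cst X c : H X -> (forall w, X w <= c) -> E X <= c.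
Proof.
move=> HX Xc; rewrite -[leRHS](sle_cst hE).
by apply: (sle_monotone hE) => //; exact: (rv_cst hH).
Qed.

Lemma E_ge_cst X c : H X -> (forall w, c <= X w) -> c <= E X.
Proof.
move=> HX Xc; rewrite -[leLHS](sle_cst hE).
by apply: (sle_monotone hE) => //; exact: (rv_cst hH).
Qed.

Lemma E_oppN X : H X -> - E (fun w => - X w) <= E X.
Proof.
move=> HX; have := sle_subadditive hE HX (H_opp HX).
rewrite (_ : (fun w => X w + - X w) = fun=> 0).
  by rewrite (sle_cst hE); lra.
by apply/funext => w; rewrite subrr.
Qed.

Lemma E_sum (X : nat -> Omega -> R) n : (forall i, H (X i)) ->
  E (fun w => \sum_(i < n) X i w) <= \sum_(i < n) E (X i).
Proof.
move=> HX; elim: n => [|n IH].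
  rewrite big_ord0 (_ : (fun w => _) = fun=> 0) ?(sle_cst hE)//.
  by apply/funext => w; rewrite big_ord0.
rewrite big_ord_recr/=; apply: (@le_trans _ _
  (E (fun w => \sum_(i < n) X i w) + E (X n))); last by rewrite lerD2r.
apply: E_leD => //; do ?exact: H_sum.
by move=> w; rewrite big_ord_recr.
Qed.

(** Tightness is Markov's inequality for [|X|], which belongs to [H] and thus has a
    finite expectation. *)
Lemma sublinear_law_rv X : H X -> sublinear_law (fun f => E (fun w => f (X w))).
Proof.
move=> HX; split=> [f g bf bg fg|c|f g bf bg|a f bf a0|e e0].
- by apply: (sle_monotone hE) => //; exact: H_comp.
- exact: (sle_cst hE).
- by apply: (sle_subadditive hE); exact: H_comp.
- by apply: (sle_poshom hE) => //; exact: H_comp.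
have HA : H (fun w => `|X w|) by exact: (rv_abs hH).
pose c := E (fun w => `|X w|).
have c0 : 0 <= c by exact: E_ge_cst.
pose K := c / e + 1.
have K1 : 1 <= K by rewrite /K lerDr divr_ge0// ltW.
have Ki : 0 <= K^-1 by rewrite invr_ge0; lra.
exists K; apply: (@le_trans _ _ (K^-1 * c)); last first.
  rewrite ler_pdivrMl; last by lra.
  by rewrite /K mulrDl divfK ?gt_eqF//; lra.
rewrite -(sle_poshom hE)//; apply: (sle_monotone hE) => //.
- exact: (rv_scale hH).
- apply: (H_comp HX (f := fun x => 1 + (ramp _ _ x - ramp _ _ x))).
  apply: bounded_lip_add; first exact: bounded_lip_cst.
  apply: bounded_lip_add; first exact: bounded_lip_ramp.
  by apply: bounded_lip_opp; exact: bounded_lip_ramp.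
- move=> w; have [XK|KX] := leP `|X w| K.
    move: XK; rewrite ler_norml => /andP[X1 X2].
    rewrite [ramp (- K - 1) _ _]ramp_right; [|lra|lra].
    rewrite ramp_left; [|lra|lra].
    by rewrite add0r subrr mulr_ge0.
  apply: (@le_trans _ _ 1); last by rewrite ler_pdivlMl ?mulr1 ?ltW//; lra.
  have := @ramp_le1 R (- K - 1) (- K) (X w).
  have := @ramp_ge0 R K (K + 1) (X w).
  have [X0|X0] := leP 0 (X w); [rewrite [ramp (- K - 1) _ _]ramp_right; lra|].
  rewrite [ramp K _ _]ramp_left; lra.
Qed.

Lemma law_set_represents X : H X -> represents E X (law_set E X).
Proof.
move=> HX; rewrite /law_set; case: xgetP => [P _ []//|no].
have HL := sublinear_law_rv HX; exfalso.
apply: (no (dominated_probs (fun f => E (fun w => f (X w))))); split.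
- exact: dominated_probs_convex.
- exact: dominated_probs_compact.
- by move=> f /CbLipP bf; exact: (law_represented HL).
Qed.

Lemma law_set_nonempty X : H X -> law_set E X !=set0.
Proof.
move=> HX; apply/set0P/eqP => P0.
have := law_set_represents HX ((CbLipP _).2 (bounded_lip_cst 1)).
rewrite P0 image_set0 sup0 (sle_cst hE) => /eqP.
by rewrite oner_eq0.
Qed.

(** On test functions nothing changes, so a function in [C_b(R)] can be handled by
    comparing it with test functions. *)
Lemma expect_CbE X f : H X -> bounded_lip f ->
  expect_Cb E f X = E (fun w => f (X w)).
Proof. by move=> HX bf; rewrite (law_set_represents HX)//; apply/CbLipP. Qed.

Lemma expect_Cb_mono X f g : H X -> Cb f -> Cb g -> (forall x, f x <= g x) ->
  expect_Cb E f X <= expect_Cb E g X.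
Proof.
move=> HX Cf Cg fg; have [mu0 P0] := law_set_nonempty HX.
have /CbP[_ [B gB]] := Cg.
apply: ge_sup; first by exists (\int[mu0]_x f x); exists mu0.
move=> _ [mu Pmu <-]; have Mm := Rintegral_mean mu.
apply: (@le_trans _ _ (\int[mu]_x g x)); first exact: (mean_mono Mm).
apply: ub_le_sup; last by exists mu.
exists B => _ [nu _ <-]; have Mn := Rintegral_mean nu.
rewrite -[leRHS](mean_cst B Mn); apply: (mean_mono Mn) => //.
  exact: Cb_cst.
by move=> x; apply: le_trans (gB x); exact: ler_norm.
Qed.

End RandomVariables.

(** * The transition operator of the partial sums *)

(** One step of the random walk with increments [h X0], acting on functions of
    its position. *)
Definition transition (R : realType) (Omega : Type) (E : (Omega -> R) -> R)
    (X0 : Omega -> R) (h f : R -> R) (s : R) : R :=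
  E (fun w => f (s + h (X0 w))).

Section Transition.
Context (R : realType) (Omega : Type) (H : set (Omega -> R))
  (E : (Omega -> R) -> R) (X : nat -> Omega -> R).
Hypotheses (hH : rv_space H) (hE : sublinear_expectation H E).
Hypotheses (HX : forall i, H (X i)) (iidX : iid E X).
Implicit Types (f h : R -> R).

Local Notation T := (transition E (X 0%N)).

Lemma bounded_lip_shift f h s : bounded_lip f -> lip h ->
  bounded_lip (fun x => f (s + h x)).
Proof.
move=> bf lh; apply: (bounded_lip_comp bf (g := fun x => s + h x)).
by apply: lip_add => //; exact: lip_cst.
Qed.

Lemma H_shift f h s : bounded_lip f -> lip h -> H (fun w => f (s + h (X 0%N w))).
Proof.
move=> bf lh; apply: (H_comp hH (HX 0) (f := fun x => f (s + h x))).
exact: bounded_lip_shift.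
Qed.

Lemma transition_bounded_lip f h : bounded_lip f -> lip h -> bounded_lip (T h f).
Proof.
move=> bf lh; have Hf s := H_shift s bf lh.
have [/lip_posk[k k0 fk] [B fB]] := bf; split; last first.
  exists B => s; rewrite ler_norml; apply/andP; split.
    by apply: (E_ge_cst hH hE) => // w; have := fB (s + h (X 0%N w));
      rewrite ler_norml => /andP[].
  apply: (E_le_cst hH hE) => // w; apply: le_trans (fB _); exact: ler_norm.
have half s t : T h f s - T h f t <= k * `|s - t|.
  rewrite lerBlDl -(E_addc hH hE)//; apply: (sle_monotone hE) => //.
    exact: (H_addc hH).
  move=> w; have := fk (s + h (X 0%N w)) (t + h (X 0%N w)).
  rewrite opprD addrACA subrr addr0 ler_norml => /andP[_]; lra.
exists k => s t; rewrite ler_norml half andbT.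
by have := half t s; rewrite distrC; lra.
Qed.

Lemma iter_transition_bounded_lip f h k : bounded_lip f -> lip h ->
  bounded_lip (iter k (T h) f).
Proof.
by move=> bf lh; elim: k => //= k; move/transition_bounded_lip; exact.
Qed.

(** Independence integrates out the last variable for fixed values of the others;
    identical distribution makes the resulting operator the same for all [k]. *)
Lemma expectation_last_step f h s k : bounded_lip f -> lip h ->
  E (fun w => f (s + \sum_(j < k.+1) h (X j w))) =
  E (fun w => T h f (s + \sum_(j < k) h (X j w))).
Proof.
move=> bf lh; case: k => [|i].
  rewrite (_ : (fun w => T _ _ _) = fun=> T h f s); last first.
    by apply/funext => w; rewrite big_ord0 addr0.
  rewrite (sle_cst hE) /transition; congr E; apply/funext => w.
  by rewrite big_ord1.
have [indep ident] := iidX.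
have sumE (z : 'rV[R]_i.+1) (y : R) :
    \sum_j h (row_mx z y%:M ord0 j) = \sum_j h (z ord0 j) + h y.
  rewrite big_split_ord/= big_ord1; congr (_ + _).
    by apply: eq_bigr => j _; rewrite row_mxEl.
  by rewrite row_mxEr mxE eqxx mulr1n.
have := indep i _ (CbLip_sum (i.+1 + 1) s bf lh).
rewrite (_ : (fun w => f _) =
    fun w => f (s + \sum_(j < i.+2) h (X j w))); last first.
  apply/funext => w; rewrite sumE [in RHS]big_ord_recr/=; congr (f (s + (_ + _))).
  by apply: eq_bigr => j _; rewrite mxE.
move=> ->; congr E; apply/funext => w /=.
rewrite /transition.
rewrite -(ident i.+1 (fun x => f (s + \sum_(j < i.+1) h (X j w) + h x))).
  congr E; apply/funext => w'; rewrite sumE addrA; congr (f (s + _ + _)).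
  by apply: eq_bigr => j _; rewrite mxE.
by apply/CbLipP; exact: bounded_lip_shift.
Qed.

Lemma expectation_iter f h s k : bounded_lip f -> lip h ->
  E (fun w => f (s + \sum_(j < k) h (X j w))) = iter k (T h) f s.
Proof.
move=> bf lh; elim: k f bf => [|k IH] f bf.
  rewrite (_ : (fun w => _) = fun=> f s) ?(sle_cst hE)//.
  by apply/funext => w; rewrite big_ord0 addr0.
rewrite (expectation_last_step s k bf lh) IH ?iterSr//.
exact: transition_bounded_lip.
Qed.

End Transition.

(** * A weak law for bounded increments *)

Section BoundedIncrements.
Context (R : realType) (Omega : Type) (H : set (Omega -> R))
  (E : (Omega -> R) -> R) (X : nat -> Omega -> R).
Hypotheses (hH : rv_space H) (hE : sublinear_expectation H E).
Hypotheses (HX : forall i, H (X i)) (iidX : iid E X).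
Variable h : R -> R.
Hypothesis bh : bounded_lip h.
Implicit Types (f : R -> R).

Let lh : lip h. Proof. by case: bh. Qed.
Local Notation T := (transition E (X 0%N) h).
Local Notation Y := (fun w => h (X 0%N w)).
Local Notation up := (E Y).
Local Notation lo := (- E (fun w => - h (X 0%N w))).

Variable C : R.
Hypothesis variance : forall m, lo <= m <= up ->
  E (fun w => (h (X 0%N w) - m) ^+ 2) <= C.

Let HY : H Y. Proof. exact: (H_comp hH (HX 0) bh). Qed.

Lemma lo_le_up : lo <= up.
Proof. by rewrite (E_oppN hH hE). Qed.

Lemma bounded_lip_sqr m : bounded_lip (fun x => (h x - m) ^+ 2).
Proof.
have [/lip_posk[k k0 hk] [B hB]] := bh.
have hB' x : `|h x - m| <= B + `|m|.
  by apply: le_trans (ler_normB _ _) _; rewrite lerD2r.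
split; last first.
  by exists ((B + `|m|) ^+ 2) => x; rewrite normrX lerXn2r ?nnegrE//;
    exact: le_trans (normr_ge0 _) (hB' x).
exists (2 * (B + `|m|) * k) => x y.
rewrite subr_sqr opprB addrA subrK normrM mulrC -mulrA.
apply: ler_pM => //.
by apply: le_trans (ler_normD _ _) _; have := hB' x; have := hB' y; lra.
Qed.

Let HYsqr b m : H (fun w => b * (h (X 0%N w) - m) ^+ 2).
Proof. apply: (rv_scale hH); exact: (H_comp hH (HX 0) (bounded_lip_sqr m)). Qed.

Let HYlin t m : H (fun w => t * (h (X 0%N w) - m)).
Proof. by apply: (rv_scale hH); apply: (H_addc hH). Qed.

Let E_pos t m : 0 <= t -> E (fun w => t * (h (X 0%N w) - m)) = t * (up - m).
Proof.
move=> t0; rewrite (sle_poshom hE)//; last exact: (H_addc hH).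
by rewrite (E_addc hH hE).
Qed.

Let E_neg t m : t <= 0 -> E (fun w => t * (h (X 0%N w) - m)) = - t * (m - lo).
Proof.
move=> t0; rewrite (_ : (fun w => _) = fun w => - t * (- h (X 0%N w) + m)).
  rewrite (sle_poshom hE) ?oppr_ge0//; last by apply: (H_addc hH); exact: (H_opp hH).
  rewrite (E_addc hH hE); last exact: (H_opp hH).
  by rewrite opprK addrC.
by apply/funext => w; ring.
Qed.

(** Expand the square around a mean: whatever the sign of the coefficient of the
    linear term, one of the two extreme means makes its expectation vanish, so that
    only the variance contributes. *)
Lemma transition_upper f (A b c d : R) : bounded_lip f -> 0 <= b ->
  (forall s a, c <= a <= d -> f s <= A + b * (s - a) ^+ 2) ->
  forall s a, c - lo <= a <= d - up ->
    T f s <= A + b * C + b * (s - a) ^+ 2.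
Proof.
move=> bf b0 fA s a /andP[ca ad]; have lu := lo_le_up.
pose t := 2 * b * (s - a).
have [m mlu Em] : exists2 m, lo <= m <= up &
    E (fun w => t * (h (X 0%N w) - m)) = 0.
  have [sa|sa] := leP a s.
    exists up; first by rewrite lu lexx.
    by rewrite E_pos ?subrr ?mulr0// !mulr_ge0// subr_ge0.
  exists lo; first by rewrite lu lexx.
  rewrite E_neg ?subrr ?mulr0// mulr_ge0_le0 ?mulr_ge0// subr_le0; exact: ltW.
have H1 : H (fun w => t * (h (X 0%N w) - m) + (A + b * (s - a) ^+ 2)).
  exact: (H_addc hH).
have : T f s <= E (fun w => t * (h (X 0%N w) - m) + (A + b * (s - a) ^+ 2)) +
    E (fun w => b * (h (X 0%N w) - m) ^+ 2).
  apply: (E_leD hH hE) => //; first exact: (H_shift hH HX s bf lh).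
  have amcd : c <= a + m <= d by move: mlu => /andP[? ?]; apply/andP; split; lra.
  move=> w; apply: le_trans (fA (s + h (X 0%N w)) _ amcd) _; rewrite /t.
  by rewrite le_eqVlt; apply/orP; left; apply/eqP; ring.
rewrite (E_addc hH hE)// Em (sle_poshom hE)//; last first.
  exact: (H_comp hH (HX 0) (bounded_lip_sqr m)).
by have := ler_wpM2l b0 (variance mlu); lra.
Qed.

(** For any [m] between the lower and the upper mean, the linear term has
    nonnegative upper expectation, whatever its sign. *)
Lemma transition_lower f (A b a m : R) : bounded_lip f -> 0 <= b ->
  lo <= m <= up -> (forall s, A - b * (s - a) ^+ 2 <= f s) ->
  forall s, A - b * C - b * (s - (a - m)) ^+ 2 <= T f s.
Proof.
move=> bf b0 mlu fA s; pose t := - (2 * b * (s - (a - m))).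
have Em : 0 <= E (fun w => t * (h (X 0%N w) - m)).
  move: (mlu) => /andP[lm mu]; have [t0|t0] := leP 0 t.
    by rewrite E_pos// mulr_ge0// subr_ge0.
  rewrite E_neg; last exact: ltW.
  by rewrite mulr_ge0 ?subr_ge0// oppr_ge0 ltW.
have : E (fun w => t * (h (X 0%N w) - m) + (A - b * (s - (a - m)) ^+ 2)) <=
    T f s + E (fun w => b * (h (X 0%N w) - m) ^+ 2).
  apply: (E_leD hH hE) => //; [exact: (H_addc hH)|exact: (H_shift hH HX s bf lh)|].
  move=> w; rewrite -lerBlDr; apply: le_trans (fA _); rewrite /t.
  by rewrite le_eqVlt; apply/orP; left; apply/eqP; ring.
rewrite (E_addc hH hE)// (sle_poshom hE)//; last first.
  exact: (H_comp hH (HX 0) (bounded_lip_sqr m)).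
by have := ler_wpM2l b0 (variance mlu); lra.
Qed.

Lemma iter_transition_upper f (A b c d : R) k : bounded_lip f -> 0 <= b ->
  (forall s a, c <= a <= d -> f s <= A + b * (s - a) ^+ 2) ->
  forall s a, c - k%:R * lo <= a <= d - k%:R * up ->
    iter k T f s <= A + k%:R * (b * C) + b * (s - a) ^+ 2.
Proof.
move=> bf b0 fA; elim: k => [|k IH] s a.
  by rewrite !mul0r !subr0 addr0; exact: fA.
move=> aab.
have := transition_upper (iter_transition_bounded_lip hH hE HX k bf lh) b0 IH.
move=> /(_ s a); rewrite (_ : A + k%:R * (b * C) + b * C = A + k.+1%:R * (b * C)).
  by apply; move: aab; rewrite -natr1; lra.
by rewrite -natr1; ring.
Qed.

Lemma iter_transition_lower f (A b a m : R) k : bounded_lip f -> 0 <= b ->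
  lo <= m <= up -> (forall s, A - b * (s - a) ^+ 2 <= f s) ->
  forall s, A - k%:R * (b * C) - b * (s - (a - k%:R * m)) ^+ 2 <= iter k T f s.
Proof.
move=> bf b0 mlu fA; elim: k => [|k IH] s.
  by rewrite !mul0r !subr0; exact: fA.
have := transition_lower (iter_transition_bounded_lip hH hE HX k bf lh) b0 mlu IH s.
rewrite (_ : a - k%:R * m - m = a - k.+1%:R * m); last by rewrite -natr1; ring.
by rewrite (_ : A - k%:R * (b * C) - b * C = A - k.+1%:R * (b * C))// -natr1; ring.
Qed.

(** Replaces a Lipschitz bound by a quadratic one. *)
Let young (L t e : R) : 0 < e -> L * t <= e + L ^+ 2 / (4 * e) * t ^+ 2.
Proof.
move=> e0; rewrite -subr_ge0.
have -> : e + L ^+ 2 / (4 * e) * t ^+ 2 - L * t =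
    (2 * e - L * t) ^+ 2 / (4 * e) by field; rewrite gt_eqF.
by rewrite divr_ge0 ?sqr_ge0// mulr_ge0// ltW.
Qed.

Section Averages.
Variables (f : R -> R) (L e : R) (n : nat).
Hypotheses (bf : bounded_lip f) (fL : forall x y, `|f x - f y| <= L * `|x - y|).
Hypotheses (e0 : 0 < e) (n0 : (0 < n)%N).

Let nR0 : 0 < n%:R :> R. Proof. by rewrite ltr0n. Qed.
Let b : R := L ^+ 2 / (4 * e) / n%:R ^+ 2.
Let b0 : 0 <= b.
Proof. by rewrite !divr_ge0 ?sqr_ge0// mulr_ge0// ltW. Qed.

Let bfn : bounded_lip (fun s => f (s / n%:R)).
Proof.
by apply: (bounded_lip_comp bf (g := fun s => s / n%:R)); exact: lip_divr.
Qed.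

Let scaled s a : `|f (s / n%:R) - f (a / n%:R)| <= e + b * (s - a) ^+ 2.
Proof.
apply: le_trans (fL _ _) _; apply: le_trans (young _ _ e0) _.
rewrite lerD2l real_normK ?num_real// -mulrBl exprMn exprVn /b.
by rewrite [leLHS]mulrA [leLHS]mulrAC.
Qed.

Let averageE : E (fun w => f ((\sum_(i < n) h (X i w)) / n%:R)) =
  iter n T (fun s => f (s / n%:R)) 0.
Proof.
rewrite -(expectation_iter hH hE HX iidX 0 n bfn lh).
by congr E; apply/funext => w; rewrite add0r.
Qed.

Let nb : n%:R * (b * C) = L ^+ 2 * C / (4 * e * n%:R).
Proof. by rewrite /b; field; rewrite !gt_eqF. Qed.

Lemma average_upper A : (forall m, lo <= m <= up -> f m <= A) ->
  E (fun w => f ((\sum_(i < n) h (X i w)) / n%:R)) <=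
  A + e + L ^+ 2 * C / (4 * e * n%:R).
Proof.
move=> fA; rewrite averageE -nb.
have H1 s a : n%:R * lo <= a <= n%:R * up -> f (s / n%:R) <= A + e + b * (s - a) ^+ 2.
  move=> /andP[a1 a2]; have := scaled s a; rewrite ler_norml => /andP[_].
  have := fA (a / n%:R); rewrite ler_pdivlMr// ler_pdivrMr// ![_ * n%:R]mulrC.
  by rewrite a1 a2 => /(_ isT); lra.
have := iter_transition_upper (k := n) (a := 0) bfn b0 H1 0.
by rewrite !subrr lexx expr0n/= mulr0 addr0; exact.
Qed.

Lemma average_lower m : lo <= m <= up ->
  f m - e - L ^+ 2 * C / (4 * e * n%:R) <=
  E (fun w => f ((\sum_(i < n) h (X i w)) / n%:R)).
Proof.
move=> mlu; rewrite averageE -nb.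
have H1 s : f m - e - b * (s - n%:R * m) ^+ 2 <= f (s / n%:R).
  have := scaled s (n%:R * m); rewrite ler_norml => /andP[+ _].
  by rewrite [n%:R * m / _]mulrAC divff ?gt_eqF// mul1r; lra.
have := iter_transition_lower n bfn b0 mlu H1 0.
by rewrite !subrr expr0n/= mulr0 subr0.
Qed.

End Averages.

End BoundedIncrements.

(** * Truncation *)

(** A Lipschitz version of the indicator function of [K + 1 <= |x|]. *)
Definition tail (R : realType) (K x : R) : R := 1 - ramp K (K + 1) `|x|.

Definition trunc (R : realType) (n : nat) (x : R) : R :=
  Num.min (Num.max (- n%:R) x) n%:R.

Section Tail.
Context (R : realType).
Implicit Types K x y : R.

Lemma tail_le1 K x : tail K x <= 1.
Proof. by rewrite /tail lerBlDr lerDl ramp_ge0. Qed.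

Lemma tail_ge0 K x : 0 <= tail K x.
Proof. by rewrite /tail subr_ge0 ramp_le1. Qed.

Lemma tail_small K x : `|x| <= K -> tail K x = 0.
Proof. by move=> xK; rewrite /tail ramp_left ?subrr// ltrDl. Qed.

Lemma tail_large K x : K + 1 <= `|x| -> tail K x = 1.
Proof. by move=> xK; rewrite /tail ramp_right ?subr0// ltrDl. Qed.

Lemma tail_between K x : K <= `|x| <= K + 1 -> tail K x = `|x| - K.
Proof.
move=> /andP[K1 K2]; rewrite /tail /ramp (_ : K + 1 - K = 1); last by lra.
by rewrite divr1 max_r ?subr_ge0// min_r; lra.
Qed.

Lemma tail_bounded_lip K : bounded_lip (tail K).
Proof.
have [lr br] := bounded_lip_ramp K (K + 1).
have bl : bounded_lip (fun x => ramp K (K + 1) `|x|).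
  apply: (bounded_lip_comp (g := fun x : R => `|x|)) => //.
  by apply: lip_norm; exact: lip_id.
apply: (bounded_lip_add (f := fun=> 1)); first exact: bounded_lip_cst.
exact: bounded_lip_opp.
Qed.

Lemma tail_mono K x y : `|x| <= `|y| -> tail K x <= tail K y.
Proof.
move=> xy; have [yK|Ky] := leP (K + 1) `|y|.
  by rewrite (tail_large yK) tail_le1.
have [xK|Kx] := leP `|x| K; first by rewrite (tail_small xK) tail_ge0.
by rewrite !tail_between; lra.
Qed.

Lemma tail_le_norm K x : 1 <= K -> tail K x <= `|x|.
Proof.
move=> K1; have [xK|Kx] := leP `|x| K; first by rewrite tail_small.
by apply: le_trans (tail_le1 _ _) _; lra.
Qed.

(** The supremum is attained at [x] itself, or at the end point of the interval
    from [- n] to [n] that is closer to [x]. *)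
Lemma psiE n x : (0 < n)%N -> psi n x = n%:R * tail (n%:R - 1) x.
Proof.
move=> n0; have nR0 : 0 < n%:R :> R by rewrite ltr0n.
set A := [set z : R | n%:R <= `|z|].
pose g (y : R) : R := n%:R * \1_A y - n%:R * `|y - x|.
have g_out y : n%:R <= `|y| -> g y = n%:R - n%:R * `|y - x|.
  by move=> yn; rewrite /g indicE mem_set// mulr1.
have g_in y : `|y| < n%:R -> g y = - (n%:R * `|y - x|).
  move=> yn; rewrite /g indicE memNset ?mulr0 ?sub0r// /A/=.
  by apply/negP; rewrite -ltNge.
have gle y : g y <= n%:R * tail (n%:R - 1) x.
  have d0 : 0 <= n%:R * `|y - x| by rewrite mulr_ge0.
  have t0 : 0 <= n%:R * tail (n%:R - 1) x by rewrite mulr_ge0// tail_ge0.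
  have [yn|yn] := leP n%:R `|y|; last first.
    by rewrite g_in//; apply: le_trans t0; rewrite oppr_le0.
  rewrite g_out// -{1}[n%:R]mulr1 -mulrBr ler_wpM2l//.
  have := ler_distD x y 0; rewrite !subr0 => dy.
  have [xn|nx] := leP n%:R `|x|.
    by rewrite tail_large; [have := normr_ge0 (y - x); lra|lra].
  have [xn|nx'] := leP (n%:R - 1) `|x|.
    by rewrite tail_between; [lra|apply/andP; split; lra].
  by rewrite tail_small; lra.
have [z gz] : exists z, g z = n%:R * tail (n%:R - 1) x.
  have [nx|xn] := leP n%:R `|x|.
    exists x; rewrite g_out// subrr normr0 mulr0 subr0 tail_large ?mulr1//; lra.
  have [xn'|nx] := leP `|x| (n%:R - 1).
    by exists x; rewrite g_in// subrr normr0 mulr0 oppr0 tail_small// mulr0.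
  have tx : tail (n%:R - 1) x = `|x| - (n%:R - 1).
    by apply: tail_between; apply/andP; split; lra.
  have [x0|x0] := leP 0 x.
    exists n%:R; rewrite g_out; last by rewrite ger0_norm.
    move: (xn) tx; rewrite (ger0_norm x0) => xn1 ->.
    by rewrite ger0_norm; [ring|lra].
  exists (- n%:R); rewrite g_out; last by rewrite normrN ger0_norm.
  move: (xn) tx; rewrite (ltr0_norm x0) => xn1 ->.
  by rewrite ler0_norm; [ring|lra].
rewrite /psi -/A; apply/eqP; rewrite eq_le; apply/andP; split.
  apply: ge_sup; first by exists (g 0); exists 0.
  by move=> _ [y _ <-]; exact: gle.
rewrite -gz; apply: ub_le_sup; last by exists z.
by exists (n%:R * tail (n%:R - 1) x) => _ [y _ <-]; exact: gle.
Qed.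

Lemma psi_ge0 n x : (0 < n)%N -> 0 <= psi n x.
Proof. by move=> n0; rewrite psiE// mulr_ge0// tail_ge0. Qed.

Lemma psi_bounded_lip n : (0 < n)%N -> bounded_lip (@psi R n).
Proof.
move=> n0; rewrite (_ : psi n = fun x => n%:R * tail (n%:R - 1) x).
  by apply: bounded_lip_scale; exact: tail_bounded_lip.
by apply/funext => x; rewrite psiE.
Qed.

Lemma trunc_bounded_lip n : bounded_lip (@trunc R n).
Proof.
split.
  apply: lip_min; last exact: lip_cst.
  by apply: lip_max; [exact: lip_cst|exact: lip_id].
apply: (bdd_itv (a := - n%:R) (b := n%:R)) => x; rewrite /trunc.
rewrite le_min ge_min lexx orbT andbT le_max lexx/=.
by rewrite ge0_cp// oppr_le0.
Qed.

Lemma trunc_id n x : `|x| <= n%:R -> trunc n x = x.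
Proof.
by rewrite ler_norml => /andP[nx xn]; rewrite /trunc max_r// min_l.
Qed.

Lemma trunc_right n x : n%:R <= x -> trunc n x = n%:R.
Proof.
by move=> nx; rewrite /trunc max_r ?min_r//; apply: le_trans nx; rewrite ge0_cp.
Qed.

Lemma trunc_left n x : x <= - n%:R -> trunc n x = - n%:R.
Proof. by move=> xn; rewrite /trunc max_l// min_l// ge0_cp. Qed.

Lemma truncN n x : trunc n (- x) = - trunc n x.
Proof.
have [xn|] := leP `|x| n%:R; first by rewrite !trunc_id ?normrN.
rewrite lter_normr => /orP[] /ltW nx.
  by rewrite trunc_left ?lerN2// trunc_right.
by rewrite trunc_right// trunc_left ?opprK// lerNr.
Qed.

Lemma norm_trunc n x : `|trunc n x| = Num.min `|x| n%:R.
Proof.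
have [xn|] := leP `|x| n%:R; first by rewrite trunc_id.
rewrite lter_normr => /orP[] /ltW nx.
  by rewrite trunc_right// ger0_norm.
by rewrite trunc_left ?normrN ?ger0_norm// lerNr.
Qed.

(** From [n] to [n + 1] the square of [min |x| n] grows only if [|x| > n]: by
    [2 n + 1] when [|x| > n + 1], and by [(|x| - n) (|x| + n)] otherwise.  Both are
    at most [2 * psi n.+1 x]. *)
Lemma trunc_sqr_le n x : trunc n x ^+ 2 <= 2 * \sum_(k < n) psi k.+1 x.
Proof.
rewrite -real_normK ?num_real// norm_trunc; elim: n => [|n IH].
  by rewrite big_ord0 mulr0 min_r; [rewrite expr0n|exact: normr_ge0].
rewrite big_ord_recr/= mulrDr psiE//.
have nn : n.+1%:R = n%:R + 1 :> R by rewrite -natr1.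
have n0 : 0 <= n%:R :> R by [].
have [xn|nx] := leP `|x| n%:R.
  rewrite min_l; last by rewrite nn; lra.
  move: IH; rewrite min_l// tail_small; last by rewrite nn; lra.
  by rewrite !mulr0 addr0.
move: IH; rewrite min_r; last exact: ltW.
have [xn1|n1x] := leP `|x| n.+1%:R.
  rewrite tail_between; last by rewrite nn; apply/andP; split; lra.
  rewrite nn; rewrite nn in xn1; set s := 2 * _; set a := `|x| in nx xn1 *.
  by move: s => s; nra.
rewrite tail_large; last by rewrite subrK ltW.
by rewrite nn; set s := 2 * _; move: s => s; nra.
Qed.

End Tail.


Section TruncatedSums.
Context (R : realType) (Omega : Type) (H : set (Omega -> R))
  (E : (Omega -> R) -> R) (X : nat -> Omega -> R).
Hypotheses (hH : rv_space H) (hE : sublinear_expectation H E).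
Hypotheses (HX : forall i, H (X i)) (iidX : iid E X).
Implicit Types (f h : R -> R).

Local Notation c := (E (fun w => `|X 0%N w|)).
Local Notation tau := (fun n => E (fun w => psi n (X 0%N w))).
Local Notation up := (fun n => E (fun w => trunc n (X 0%N w))).
Local Notation lo := (fun n => - E (fun w => - trunc n (X 0%N w))).

Let HA : H (fun w => `|X 0%N w|). Proof. exact: (rv_abs hH). Qed.

Let Htrunc n : H (fun w => trunc n (X 0%N w)).
Proof. exact: (H_comp hH (HX 0) (trunc_bounded_lip R n)). Qed.

Lemma trunc_mean_bound n m : lo n <= m <= up n -> - c <= m <= c.
Proof.
have nt w : `|trunc n (X 0%N w)| <= `|X 0%N w|.
  by rewrite norm_trunc ge_min lexx.
move=> /andP[lm mu]; apply/andP; split.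
  apply: le_trans lm; rewrite lerN2; apply: (sle_monotone hE) => //.
    exact: (H_opp hH).
  by move=> w; apply: le_trans (nt w); rewrite -normrN; exact: ler_norm.
apply: le_trans mu _; apply: (sle_monotone hE) => // w.
by apply: le_trans (nt w); exact: ler_norm.
Qed.

(** No square integrability is available; but if the tails [tau] tend to 0, then
    so do their averages, and this bound is [o(n)]. *)
Lemma truncated_variance n m : lo n <= m <= up n ->
  E (fun w => (trunc n (X 0%N w) - m) ^+ 2) <=
  4 * (\sum_(k < n) tau k.+1) + 2 * c ^+ 2.
Proof.
move=> mlu; have /andP[cm mc] := trunc_mean_bound mlu.
have mc2 : m ^+ 2 <= c ^+ 2.
  by rewrite -(real_normK (num_real m)) lerXn2r ?nnegrE// ?ler_norml ?cm//; lra.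
have Hpsi k : H (fun w => psi k.+1 (X 0%N w)).
  exact: (H_comp hH (HX 0) (psi_bounded_lip R (ltn0Sn k))).
pose S w := \sum_(k < n) psi k.+1 (X 0%N w).
have HS : H S by exact: (H_sum hH n Hpsi).
have H4 : H (fun w => 4 * S w) by exact: (rv_scale hH).
apply: (@le_trans _ _ (E (fun w => 4 * S w + 2 * c ^+ 2))).
  apply: (sle_monotone hE).
  - exact: (H_addc hH).
  - apply: (H_comp hH (HX 0) (f := fun x => (trunc n x - m) ^+ 2)).
    exact: bounded_lip_sqr (trunc_bounded_lip R n) m.
  - move=> w; have := trunc_sqr_le n (X 0%N w); rewrite -/(S w).
    by have := sqr_ge0 (trunc n (X 0%N w) + m); rewrite sqrrD sqrrB; lra.
rewrite (E_addc hH hE)// lerD2r (sle_poshom hE)// ler_wpM2l//.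
exact: (E_sum hH hE n Hpsi).
Qed.

(** The two averages differ only if [|X i| > n] for some [i < n], and the upper
    probability of each of these events is at most [tau n / n]. *)
Lemma truncation_error f B n : bounded_lip f -> (forall x, `|f x| <= B) ->
  (0 < n)%N ->
  `|E (fun w => f ((\sum_(i < n) X i w) / n%:R)) -
    E (fun w => f ((\sum_(i < n) trunc n (X i w)) / n%:R))| <= 2 * B * tau n.
Proof.
move=> bf fB n0; have nR0 : 0 < n%:R :> R by rewrite ltr0n.
have B0 : 0 <= B by exact: le_trans (normr_ge0 _) (fB 0).
have bfn : bounded_lip (fun s => f (s / n%:R)).
  by apply: (bounded_lip_comp bf (g := fun s => s / n%:R)); exact: lip_divr.
pose S w := (\sum_(i < n) X i w) / n%:R.
pose S' w := (\sum_(i < n) trunc n (X i w)) / n%:R.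
have HS : H (fun w => f (S w)).
  have := H_comp_sum hH n 0 HX bfn (lip_id R).
  by congr (H _); apply/funext => w; rewrite add0r.
have HS' : H (fun w => f (S' w)).
  have := H_comp_sum hH n 0 HX bfn (proj1 (trunc_bounded_lip R n)).
  by congr (H _); apply/funext => w; rewrite add0r.
pose b := 2 * B / n%:R.
have b0 : 0 <= b by rewrite /b divr_ge0 ?mulr_ge0.
have bpsi : bounded_lip (fun x => b * psi n x).
  by apply: bounded_lip_scale; exact: psi_bounded_lip.
have Hpsi i : H (fun w => b * psi n (X i w)) by exact: (H_comp hH (HX i) bpsi).
pose Z w := \sum_(i < n) b * psi n (X i w).
have HZ : H Z by exact: (H_sum hH n Hpsi).
have EZ : E Z <= 2 * B * tau n.
  apply: le_trans (E_sum hH hE n Hpsi) _.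
  rewrite (eq_bigr (fun=> b * tau n)); last first.
    move=> i _; rewrite (iidX.2 i (fun x => b * psi n x)); last exact/CbLipP.
    rewrite (sle_poshom hE)//.
    exact: (H_comp hH (HX 0) (psi_bounded_lip R n0)).
  rewrite sumr_const card_ord -mulr_natr /= /b.
  move: (E (fun w => psi n (X 0%N w))) => t.
  by rewrite le_eqVlt; apply/orP; left; apply/eqP; field; rewrite gt_eqF.
have dist w : `|f (S w) - f (S' w)| <= Z w.
  have Zi0 i : 0 <= b * psi n (X i w) by rewrite mulr_ge0// psi_ge0.
  have [/forallP small|/forallPn[i]] := boolP [forall i : 'I_n, `|X i w| <= n%:R].
    rewrite (_ : S' w = S w) ?subrr ?normr0 ?sumr_ge0//.
    by rewrite /S' /S; congr (_ / _); apply: eq_bigr => i _; rewrite trunc_id.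
  rewrite -ltNge => Xi; apply: (@le_trans _ _ (2 * B)).
    by apply: le_trans (ler_normB _ _) _; have := fB (S w); have := fB (S' w); lra.
  rewrite /Z (bigD1 i)//= ler_wpDr ?sumr_ge0//.
  by rewrite psiE// tail_large ?mulr1 /b ?divfK ?gt_eqF//; lra.
rewrite ler_norml; apply/andP; split.
  have : E (fun w => f (S' w)) <= E (fun w => f (S w)) + E Z.
    apply: (E_leD hH hE) => // w; have := dist w.
    by rewrite ler_norml => /andP[]; lra.
  rewrite -/(S) -/(S'); lra.
have : E (fun w => f (S w)) <= E (fun w => f (S' w)) + E Z.
  apply: (E_leD hH hE) => // w; have := dist w.
  by rewrite ler_norml => /andP[]; lra.
lra.
Qed.

(** The comparison is with the truncated means for the same [n], because their
    convergence is a hypothesis in one direction and a conclusion in the other. *)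
Lemma weak_law f e : tau n @[n --> \oo] --> 0 -> bounded_lip f -> 0 < e ->
  \forall n \near \oo,
    (forall A, (forall m, lo n <= m <= up n -> f m <= A) ->
      E (fun w => f ((\sum_(i < n) X i w) / n%:R)) <= A + e) /\
    (forall m, lo n <= m <= up n ->
      f m - e <= E (fun w => f ((\sum_(i < n) X i w) / n%:R))).
Proof.
move=> tau0 bf e0; have [/lip_posk[L L0 fL] [B fB]] := bf.
pose C n := 4 * (\sum_(k < n) tau k.+1) + 2 * c ^+ 2.
have C0 : C n / n%:R @[n --> \oo] --> 0.
  rewrite -(cvg_shiftS (fun n => C n / n%:R))/=.
  have ces : arithmetic_mean (fun k => tau k.+1) @ \oo --> 0.
    by apply: cesaro; rewrite (cvg_shiftS tau).
  have har : 2 * c ^+ 2 * harmonic n @[n --> \oo] --> 2 * c ^+ 2 * 0.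
    by apply: cvgM; [exact: cvg_cst|exact: cvg_harmonic].
  have : 4 * arithmetic_mean (fun k => tau k.+1) n + 2 * c ^+ 2 * harmonic n
      @[n --> \oo] --> 4 * 0 + 2 * c ^+ 2 * 0.
    by apply: cvgD => //; apply: cvgM => //; exact: cvg_cst.
  rewrite !mulr0 addr0; apply: cvg_trans; apply: near_eq_cvg; near=> n.
  rewrite /C /arithmetic_mean /harmonic/= /series/= big_mkord.
  by rewrite mulrDl; ring.
have e30 : 0 < e / 3 by lra.
near=> n.
have n0 : (0 < n)%N by near: n; exists 1%N.
have nR0 : 0 < n%:R :> R by rewrite ltr0n.
have err1 : `|2 * B * tau n| <= e / 3.
  near: n; have : 2 * B * tau n @[n --> \oo] --> 2 * B * 0.
    by apply: cvgM => //; exact: cvg_cst.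
  rewrite mulr0 => /cvgrPdist_le/(_ _ e30); apply: filterS => n.
  by rewrite sub0r normrN.
have err2 : `|L ^+ 2 / (4 * (e / 3)) * (C n / n%:R)| <= e / 3.
  near: n; have : L ^+ 2 / (4 * (e / 3)) * (C n / n%:R) @[n --> \oo] -->
      L ^+ 2 / (4 * (e / 3)) * 0.
    by apply: cvgM => //; exact: cvg_cst.
  rewrite mulr0 => /cvgrPdist_le/(_ _ e30); apply: filterS => n.
  by rewrite sub0r normrN.
have err2E : L ^+ 2 * C n / (4 * (e / 3) * n%:R) =
    L ^+ 2 / (4 * (e / 3)) * (C n / n%:R) by field; rewrite !gt_eqF.
have := truncation_error bf fB n0.
move: err1 err2; rewrite !ler_norml => /andP[_ e1] /andP[_ e2] /andP[t1 t2].
have var m : lo n <= m <= up n ->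
    E (fun w => (trunc n (X 0%N w) - m) ^+ 2) <= C n by exact: truncated_variance.
have bt := trunc_bounded_lip R n.
split=> [A fA|m mlu].
  have := average_upper hH hE HX iidX bt var bf fL e30 n0 fA.
  by rewrite err2E; lra.
have := average_lower hH hE HX iidX bt var bf fL e30 n0 mlu.
by rewrite err2E; lra.
Unshelve. all: by end_near. Qed.

End TruncatedSums.

(** * Necessity of the tail condition *)

Section BigJump.
Context (R : realType) (Omega : Type) (H : set (Omega -> R))
  (E : (Omega -> R) -> R) (X : nat -> Omega -> R).
Hypotheses (hH : rv_space H) (hE : sublinear_expectation H E).
Hypotheses (HX : forall i, H (X i)) (iidX : iid E X).
Implicit Types (f chi : R -> R).

Local Notation T := (transition E (X 0%N) idfun).

(** The walk has [k] occasions to make a big jump, and after a jump the value is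
    at least 1/2 whatever happens later. *)
Lemma iter_transition_big_jump f chi (a p : R) n :
  bounded_lip f -> bounded_lip chi -> (forall s, 0 <= f s) ->
  (forall x, 0 <= chi x <= 1) -> (forall x, `|x| < 2 * a -> chi x = 0) ->
  p = E (fun w => chi (X 0%N w)) ->
  (forall k s, (k <= n)%N -> a <= `|s| -> 2^-1 <= iter k T f s) ->
  forall k s, (k <= n)%N -> k%:R * p / (2 * (1 + k%:R * p)) <= iter k T f s.
Proof.
move=> bf bchi f0 chi01 chi0 pE far.
have Hchi : H (fun w => chi (X 0%N w)) by exact: (H_comp hH (HX 0) bchi).
have p0 : 0 <= p.
  by rewrite pE (E_ge_cst hH hE)// => w; have /andP[] := chi01 (X 0%N w).
elim=> [s _|k IH s kn]; first by rewrite mul0r mul0r.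
have v0 : 0 <= k%:R * p by rewrite mulr_ge0.
have vS : k.+1%:R * p = k%:R * p + p by rewrite -natr1 mulrDl mul1r.
set w0 := k%:R * p / (2 * (1 + k%:R * p)) in IH.
have w0E : 2^-1 - w0 = (2 * (1 + k%:R * p))^-1 by rewrite /w0; field; lra.
have w02 : 0 <= 2^-1 - w0 by rewrite w0E invr_ge0; lra.
have half : k.+1%:R * p / (2 * (1 + k.+1%:R * p)) <= 2^-1.
  by rewrite vS ler_pdivrMr; lra.
have [sa|sa] := leP a `|s|; first by apply: le_trans half (far _ _ kn sa).
have step : w0 + (2^-1 - w0) * p <= T (iter k T f) s.
  rewrite [leLHS]addrC pE -(sle_poshom hE)// -(E_addc hH hE); last exact: (rv_scale hH).
  apply: (sle_monotone hE).
  - apply: (H_shift hH HX); last exact: lip_id.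
    by apply: (iter_transition_bounded_lip hH hE HX) => //; exact: lip_id.
  - by apply: (H_addc hH); exact: (rv_scale hH).
  move=> w; set x := X 0%N w; have /andP[c0 c1] := chi01 x.
  have [xa|xa] := ltP `|x| (2 * a).
    by rewrite (chi0 _ xa) mulr0 add0r; apply: IH; exact: ltnW.
  apply: (@le_trans _ _ 2^-1); last first.
    apply: far; first exact: ltnW.
    by have := ler_normB (s + x) s; rewrite addrAC subrr add0r; lra.
  have := ler_wpM2l w02 c1; lra.
apply: le_trans step; rewrite vS w0E -subr_ge0.
have -> : w0 = 2^-1 - (2 * (1 + k%:R * p))^-1 by rewrite -w0E; ring.
set v := k%:R * p in v0 *.
have -> : 2^-1 - (2 * (1 + v))^-1 + (2 * (1 + v))^-1 * p
    - (v + p) / (2 * (1 + (v + p))) =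
    (p * (v + p)) / (2 * (1 + v) * (1 + (v + p))) by field; lra.
by rewrite divr_ge0 ?mulr_ge0//; lra.
Qed.

(** Ottaviani's inequality supplies the hypothesis of the previous lemma: from a
    point at distance [(2 K + 2) n] the walk can come back only if its further
    increments add up to more than [(K + 1) n], which has upper probability at most
    1/2.  The conclusion follows since [v / (2 (1 + v)) <= q <= 1/4] implies
    [v <= 4 q]. *)
Lemma tail_le_excursion (K : R) n : (0 < n)%N ->
  let q m := E (fun w => tail K ((\sum_(i < m) X i w) / n%:R)) in
  (forall m, (m <= n)%N -> q m <= 2^-1) -> q n <= 4^-1 ->
  n%:R * E (fun w => tail (2 * (2 * K + 2)) (X 0%N w / n%:R)) <= 4 * q n.
Proof.
move=> n0 q qhalf qn; have nR0 : 0 < n%:R :> R by rewrite ltr0n.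
have bl (K' : R) : bounded_lip (fun s => tail K' (s / n%:R)).
  apply: (bounded_lip_comp (tail_bounded_lip K') (g := fun s => s / n%:R)).
  exact: lip_divr.
have iterE k s : iter k T (fun s => tail K (s / n%:R)) s =
    E (fun w => tail K ((s + \sum_(i < k) X i w) / n%:R)).
  by rewrite -(expectation_iter hH hE HX iidX s k (bl K) (lip_id R)).
pose p := E (fun w => tail (2 * (2 * K + 2)) (X 0%N w / n%:R)).
have far k s : (k <= n)%N -> (2 * K + 2) * n%:R <= `|s| ->
    2^-1 <= iter k T (fun s => tail K (s / n%:R)) s.
  move=> kn sa; rewrite iterE.
  have HS s' : H (fun w => tail K ((s' + \sum_(i < k) X i w) / n%:R)).
    exact: (H_comp_sum hH k s' HX (bl K) (lip_id R)).
  have : 1 <= E (fun w => tail K ((s + \sum_(i < k) X i w) / n%:R)) + q k.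
    rewrite /q (_ : (fun w => tail K ((\sum_(i < k) X i w) / n%:R)) =
      fun w => tail K ((0 + \sum_(i < k) X i w) / n%:R)); last first.
      by apply/funext => w; rewrite add0r.
    apply: le_trans (sle_subadditive hE (HS s) (HS 0)).
    apply: (E_ge_cst hH hE); first exact: (rv_add hH).
    move=> w; rewrite add0r; set x := \sum_(i < k) _.
    have [xK|Kx] := leP (K + 1) `|x / n%:R|.
      by rewrite (tail_large xK) lerDr tail_ge0.
    rewrite (tail_large (K := K) (x := (s + x) / n%:R)) ?lerDl ?tail_ge0//.
    move: Kx; rewrite !normrM normfV (ger0_norm (ltW nR0)).
    rewrite ltr_pdivrMr// ler_pdivlMr// => Kx.
    by have := ler_normB (s + x) x; rewrite addrK; lra.
  by have := qhalf k kn; lra.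
have jump := @iter_transition_big_jump (fun s => tail K (s / n%:R))
  (fun x => tail (2 * (2 * K + 2)) (x / n%:R)) ((2 * K + 2) * n%:R) p n
  (bl _) (bl _) (fun s => tail_ge0 _ _) _ _ erefl far n 0 (leqnn n).
have {jump} : n%:R * p / (2 * (1 + n%:R * p)) <= q n.
  have := jump; rewrite iterE.
  rewrite (_ : (fun w => tail K ((0 + _) / _)) =
      fun w => tail K ((\sum_(i < n) X i w) / n%:R)); last first.
    by apply/funext => w; rewrite add0r.
  apply.
  - by move=> x; rewrite tail_ge0 tail_le1.
  - move=> x xa; rewrite tail_small// normrM normfV (ger0_norm (ltW nR0)).
    by rewrite ler_pdivrMr// -mulrA ltW.
have v0 : 0 <= n%:R * p.
  rewrite mulr_ge0//; apply: (E_ge_cst hH hE).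
    exact: (H_comp hH (HX 0) (bl _)).
  by move=> w; exact: tail_ge0.
have q0 : 0 <= q n.
  apply: (E_ge_cst hH hE); last by move=> w; exact: tail_ge0.
  have := H_comp_sum hH n 0 HX (bl K) (lip_id R).
  by congr (H _); apply/funext => w; rewrite add0r.
rewrite -/p; set v := n%:R * p in v0 *; rewrite ler_pdivrMr; last by lra.
by move=> vq; nra.
Qed.

(** For large [m] the sum is compared with [m] instead of [n]; finitely many [m]
    remain, for which the sum has a finite first absolute moment. *)
Lemma sums_eventually_small (K : R) : 1 <= K ->
  E (fun w => tail K ((\sum_(i < n) X i w) / n%:R)) @[n --> \oo] --> 0 ->
  \forall n \near \oo, forall m, (m <= n)%N ->
    E (fun w => tail K ((\sum_(i < m) X i w) / n%:R)) <= 2^-1.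
Proof.
move=> K1 q0.
have h20 : 0 < 2^-1 :> R by rewrite invr_gt0.
have /cvgrPdist_le/(_ _ h20)[N _ HN] := q0.
have HA i : H (fun w => `|X i w|) by exact: (rv_abs hH).
pose D := \sum_(i < N) E (fun w => `|X i w|).
have A0 i : 0 <= E (fun w => `|X i w|) by exact: (E_ge_cst hH hE).
have HS m n : (0 < n)%N -> H (fun w => tail K ((\sum_(i < m) X i w) / n%:R)).
  move=> n0; apply: (H_comp hH (f := tail K)); last exact: tail_bounded_lip.
  have := rv_scale hH n%:R^-1 (H_sum hH m HX).
  by congr (H _); apply/funext => w; rewrite mulrC.
near=> n => m mn.
have n0 : (0 < n)%N by near: n; exists 1%N.
have nR0 : 0 < n%:R :> R by rewrite ltr0n.
have [Nm|mN] := leqP N m.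
  have := HN m Nm; rewrite /= sub0r normrN => qm.
  apply: (@le_trans _ _ (E (fun w => tail K ((\sum_(i < m) X i w) / m%:R)))); last first.
    by apply: le_trans qm; exact: ler_norm.
  have [->|m0] := posnP m.
    apply: (sle_monotone hE); [|exact: HS|].
      rewrite (_ : (fun w => _) = fun=> tail K 0); first exact: (rv_cst hH).
      by apply/funext => w; rewrite big_ord0 mul0r.
    by move=> w; rewrite big_ord0 !mul0r.
  apply: (sle_monotone hE); [exact: HS|exact: HS|] => w.
  apply: tail_mono; rewrite !normrM ler_wpM2l// !normfV.
  by rewrite !ger0_norm// lef_pV2 ?posrE ?ltr0n// ler_nat.
apply: (@le_trans _ _ (E (fun w => n%:R^-1 * \sum_(i < m) `|X i w|))).
  apply: (sle_monotone hE); [|exact: HS|].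
    by apply: (rv_scale hH); exact: (H_sum hH m HA).
  move=> w; apply: le_trans (tail_le_norm _ K1) _.
  rewrite normrM normfV (ger0_norm (ltW nR0)) mulrC ler_wpM2l ?invr_ge0//.
  exact: ler_norm_sum.
rewrite (sle_poshom hE); [|exact: (H_sum hH m HA)|by rewrite invr_ge0].
rewrite ler_pdivrMl//.
apply: (@le_trans _ _ D).
  apply: le_trans (E_sum hH hE m HA) _; rewrite /D.
  rewrite -!(big_mkord xpredT (fun i => E (fun w => `|X i w|))).
  by rewrite [leRHS](big_cat_nat _ (n := m))//= ?lerDl ?sumr_ge0// ltnW.
have : 2 * D <= n%:R by near: n; exact: nbhs_infty_ger.
by lra.
Unshelve. all: by end_near. Qed.

(** The previous bound controls jumps beyond [D n], for a constant [D]; given a level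
    [m], it is applied with [n] about [m / D]. *)
Lemma psi_vanishes (K : nat) : (0 < K)%N ->
  E (fun w => tail K%:R ((\sum_(i < n) X i w) / n%:R)) @[n --> \oo] --> 0 ->
  E (fun w => psi n (X 0%N w)) @[n --> \oo] --> 0.
Proof.
move=> K0 q0; have K1 : 1 <= K%:R :> R by rewrite ler1n.
have small := sums_eventually_small K1 q0.
pose D := (4 * K + 5)%N.
have DE : D%:R = 2 * (2 * K%:R + 2) + 1 :> R by rewrite /D natrD natrM; ring.
have Dn0 : (0 < D)%N by rewrite /D addn_gt0 orbT.
have D0 : 0 < D%:R :> R by rewrite ltr0n.
pose q n := E (fun w => tail K%:R ((\sum_(i < n) X i w) / n%:R)).
have Hpsi m : (0 < m)%N -> H (fun w => psi m (X 0%N w)).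
  by move=> m0; exact: (H_comp hH (HX 0) (psi_bounded_lip R m0)).
apply/cvgrPdist_le => /= e e0.
have e'0 : 0 < Num.min 4^-1 (e / (8 * D%:R)).
  by rewrite lt_min invr_gt0 ltr0n/= divr_gt0// mulr_gt0.
have /cvgrPdist_le/(_ _ e'0) qsmall := q0.
have [N _ HN] := filterI small qsmall.
exists (D * N.+1).+1 => // m /= Dm.
have m0 : (0 < m)%N by exact: leq_ltn_trans Dm.
pose n := (m.-1 %/ D)%N.
have Nn : (N < n)%N by rewrite /n leq_divRL// mulnC -ltnS prednK.
have n0 : (0 < n)%N by exact: leq_ltn_trans Nn.
have nR0 : 0 < n%:R :> R by rewrite ltr0n.
have [/= half] := HN n (ltnW Nn); rewrite sub0r normrN le_min => /andP[q4 qe].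
have {}q4 : q n <= 4^-1 by apply: le_trans q4; exact: ler_norm.
have {}qe : q n <= e / (8 * D%:R) by apply: le_trans qe; exact: ler_norm.
have mD : D%:R * n%:R <= m%:R - 1 :> R.
  rewrite -(natrB _ m0) subn1 -natrM ler_nat mulnC; exact: leq_trunc_div.
have mD2 : m%:R <= D%:R * (n%:R + 1) :> R.
  have : (m.-1 < D * n.+1)%N by rewrite mulnC -ltn_divLR.
  by rewrite prednK// natr1 -natrM ler_nat.
pose chi x : R := tail (2 * (2 * K%:R + 2)) (x / n%:R).
have bchi : bounded_lip chi.
  apply: (bounded_lip_comp (tail_bounded_lip _) (g := fun x : R => x / n%:R)).
  exact: lip_divr.
have Hchi : H (fun w => chi (X 0%N w)) by exact: (H_comp hH (HX 0) bchi).
have mchi x : psi m x <= m%:R * chi x.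
  rewrite psiE// ler_wpM2l//; have [xm|mx] := leP `|x| (m%:R - 1).
    by rewrite tail_small// tail_ge0.
  rewrite /chi (tail_large (x := x / n%:R)) ?tail_le1//.
  rewrite -DE normrM normfV (ger0_norm (ltW nR0)) ler_pdivlMr//.
  exact: le_trans mD (ltW mx).
have Echi0 : 0 <= E (fun w => chi (X 0%N w)).
  by apply: (E_ge_cst hH hE) => // w; exact: tail_ge0.
have key := tail_le_excursion n0 half q4.
rewrite sub0r normrN ger0_norm; last first.
  by apply: (E_ge_cst hH hE) => [|w]; [exact: Hpsi|exact: psi_ge0].
apply: (@le_trans _ _ (m%:R * E (fun w => chi (X 0%N w)))).
  rewrite -(sle_poshom hE)//; apply: (sle_monotone hE) => //.
  - exact: (rv_scale hH).
  - exact: Hpsi.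
apply: (@le_trans _ _ (2 * D%:R * (n%:R * E (fun w => chi (X 0%N w))))).
  rewrite mulrA ler_wpM2r//; apply: le_trans mD2 _.
  have : 1 <= n%:R :> R by rewrite ler1n.
  by move=> /(ler_wpM2l (ltW D0)); lra.
apply: (@le_trans _ _ (2 * D%:R * (4 * q n))).
  by rewrite ler_wpM2l// mulr_ge0.
by move: qe; rewrite ler_pdivlMr ?mulr_gt0//; lra.
Qed.

End BigJump.

(** * The law of large numbers *)

(** A Lipschitz function that vanishes on [[a, b]] and is 1 at distance at least
    [d] from this interval. *)
Definition wall (R : realType) (d a b x : R) : R :=
  Num.min 1 (d^-1 * Num.max 0 (Num.max (a - x) (x - b))).

Section Wall.
Context (R : realType).
Implicit Types (d a b x : R) (phi : R -> R).

Lemma wall_ge0 d a b x : 0 < d -> 0 <= wall d a b x.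
Proof.
by move=> d0; rewrite /wall le_min ler01/= mulr_ge0 ?invr_ge0 ?(ltW d0)// le_max lexx.
Qed.

Lemma wall_bounded_lip d a b : 0 < d -> bounded_lip (wall d a b).
Proof.
move=> d0; split; last first.
  apply: (bdd_itv (a := 0) (b := 1)) => x.
  by rewrite wall_ge0//= /wall ge_min lexx.
apply: lip_min; first exact: lip_cst.
apply: lip_scale; apply: lip_max; first exact: lip_cst.
apply: lip_max.
  by apply: lip_add; [exact: lip_cst|apply: lip_opp; exact: lip_id].
by apply: lip_add; [exact: lip_id|exact: lip_cst].
Qed.

Lemma wall_far d a b x : 0 < d -> d <= a - x \/ d <= x - b -> wall d a b x = 1.
Proof.
move=> d0 xd; rewrite /wall min_l// ler_pdivlMl// mulr1 !le_max.
by case: xd => ->; rewrite ?orbT.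
Qed.

Lemma wall_near d a b x r : 0 < d -> 0 <= r -> a - x <= r -> x - b <= r ->
  wall d a b x <= d^-1 * r.
Proof.
move=> d0 r0 ax xb; rewrite /wall ge_min; apply/orP; right.
by rewrite ler_wpM2l ?invr_ge0 ?(ltW d0)// !ge_max r0 ax xb.
Qed.

(** Just outside the interval [phi] is controlled by its continuity at the end
    points, further away by its bound [B], where the factor [2 * B] makes up for
    the possible difference between [phi] and [M]. *)
Lemma wall_majorant phi a b M e : Cb phi -> a <= b ->
  (forall x, a <= x <= b -> phi x <= M) -> 0 < e ->
  exists d B, [/\ 0 < d, 0 <= B &
    forall x, phi x <= M + e + B * wall d a b x].
Proof.
move=> /CbP[cphi [B phiB]] ab phiM e0.
have near_pt y : exists2 d, 0 < d & forall x, `|y - x| < d -> phi x <= phi y + e.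
  have [d d0 H1] := @heine R phi y y _ cphi e0.
  exists d => // x yx; have := H1 y x; rewrite lexx => /(_ isT yx).
  by rewrite ltr_norml => /andP[+ _]; lra.
have [d1 d10 phid1] := near_pt a.
have [d2 d20 phid2] := near_pt b.
have B0 : 0 <= B by exact: le_trans (normr_ge0 _) (phiB a).
have d0 : 0 < Num.min d1 d2 by rewrite lt_min d10.
exists (Num.min d1 d2), (2 * B); split; [by []|by rewrite mulr_ge0|].
move=> x; have [ax|xa] := leP a x; last first.
  have [far|close] := leP (Num.min d1 d2) (a - x).
    rewrite wall_far//; last by left.
    have := phiM a; rewrite lexx ab => /(_ isT).
    have := phiB x; have := phiB a; rewrite !ler_norml => /andP[h1 _] /andP[_ h2] h3.
    by clear -e0 h1 h2 h3; lra.
  apply: (@le_trans _ _ (M + e)); last by rewrite lerDl mulr_ge0 ?wall_ge0// mulr_ge0.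
  apply: le_trans (phid1 x _) _.
    rewrite gtr0_norm ?subr_gt0//; apply: lt_le_trans close _.
    by rewrite ge_min lexx.
  by rewrite lerD2r phiM// lexx.
have [xb|bx] := leP x b.
  apply: (@le_trans _ _ M); first by rewrite phiM// ax.
  by rewrite -addrA lerDl addr_ge0 ?(ltW e0)// mulr_ge0 ?wall_ge0// mulr_ge0.
have [far|close] := leP (Num.min d1 d2) (x - b).
  rewrite wall_far//; last by right.
  have := phiM b; rewrite lexx ab => /(_ isT).
  have := phiB x; have := phiB b; rewrite !ler_norml => /andP[h1 _] /andP[_ h2] h3.
  by clear -e0 h1 h2 h3; lra.
apply: (@le_trans _ _ (M + e)); last by rewrite lerDl mulr_ge0 ?wall_ge0// mulr_ge0.
apply: le_trans (phid2 x _) _.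
  rewrite distrC gtr0_norm ?subr_gt0//; apply: lt_le_trans close _.
  by rewrite ge_min lexx orbT.
by rewrite lerD2r phiM// lexx andbT.
Qed.

Lemma nearest_point (a b a' b' m r : R) : a <= m <= b -> a' <= b' ->
  `|a - a'| <= r -> `|b - b'| <= r ->
  exists2 m', a' <= m' <= b' & m - m' <= r /\ m' - m <= r.
Proof.
move=> /andP[am mb] ab'; rewrite !ler_norml => /andP[a1 a2] /andP[b1 b2].
have [m1|m1] := leP m a'; first by exists a'; [rewrite lexx|split; lra].
have [m2|m2] := leP b' m; first by exists b'; [rewrite lexx andbT|split; lra].
by exists m; [rewrite (ltW m1) (ltW m2)|split; lra].
Qed.

End Wall.

Section LawOfLargeNumbers.
Context (R : realType) (Omega : Type) (H : set (Omega -> R))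
  (E : (Omega -> R) -> R) (X : nat -> Omega -> R) (mu_lo mu_up : R).
Hypotheses (hH : rv_space H) (hE : sublinear_expectation H E).
Hypotheses (HX : forall i, H (X i)) (iidX : iid E X) (lohi : mu_lo <= mu_up).

Local Notation S n := (fun w => (\sum_(i < n) X i w) / n%:R).
Local Notation c := (E (fun w => `|X 0%N w|)).
Local Notation tau := (fun n => E (fun w => psi n (X 0%N w))).
Local Notation up := (fun n => E (fun w => trunc n (X 0%N w))).
Local Notation lo := (fun n => - E (fun w => - trunc n (X 0%N w))).
Local Notation max_on phi := (sup [set phi mu | mu in `[mu_lo, mu_up]]).

Let HS n : H (S n).
Proof.
have := rv_scale hH n%:R^-1 (H_sum hH n HX).
by congr (H _); apply/funext => w; rewrite mulrC.
Qed.

Let max_onE (phi : R -> R) m : mu_lo <= m <= mu_up ->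
  (forall x, mu_lo <= x <= mu_up -> phi x <= phi m) -> max_on phi = phi m.
Proof.
move=> mlu phim.
have ub : ubound [set phi mu | mu in `[mu_lo, mu_up]] (phi m).
  by move=> _ [x + <-]; rewrite /= in_itv/=; exact: phim.
have im : [set phi mu | mu in `[mu_lo, mu_up]] (phi m).
  by exists m => //=; rewrite in_itv.
apply/eqP; rewrite eq_le; apply/andP; split.
  by apply: ge_sup => //; exists (phi m).
by apply: ub_le_sup => //; exists (phi m).
Qed.

(** The functions [trunc K] and [- trunc K], with [K] so large that [trunc K] is
    the identity on all the intervals involved, recover the end points of an
    interval as maxima. *)
Lemma lln_necessary :
  (forall phi : R -> R, Cb phi ->
     expect_Cb E phi (S n) @[n --> \oo] --> max_on phi) ->
  [/\ tau n @[n --> \oo] --> 0, up n @[n --> \oo] --> mu_up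
    & lo n @[n --> \oo] --> mu_lo].
Proof.
move=> lln.
have test f m : bounded_lip f -> mu_lo <= m <= mu_up ->
    (forall x, mu_lo <= x <= mu_up -> f x <= f m) ->
    E (fun w => f (S n w)) @[n --> \oo] --> f m.
  move=> bf mlu fm; have := lln f (bounded_lip_Cb bf).
  rewrite (max_onE mlu fm); apply: cvg_trans; apply: near_eq_cvg.
  by apply: nearW => n; rewrite (expect_CbE hH hE).
have c0 : 0 <= c.
  by apply: (E_ge_cst hH hE) => [|w]; [exact: (rv_abs hH)|exact: normr_ge0].
have abs0 : 0 <= `|mu_lo| + `|mu_up| + c + 1 by rewrite !addr_ge0.
pose K := Num.bound (`|mu_lo| + `|mu_up| + c + 1).
have hK : `|mu_lo| + `|mu_up| + c + 1 < K%:R by exact: archi_boundP.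
have n1 := normr_ge0 mu_lo; have n2 := normr_ge0 mu_up.
have l1 := ler_norm mu_up; have l2 := ler_norm (- mu_lo); rewrite normrN in l2.
have K0 : (0 < K)%N by rewrite -(ltr0n R); lra.
have inK x : mu_lo <= x <= mu_up -> `|x| <= K%:R.
  by move=> /andP[x1 x2]; rewrite ler_norml; apply/andP; split; lra.
have lolo : mu_lo <= mu_lo <= mu_up by rewrite lexx.
have upup : mu_lo <= mu_up <= mu_up by rewrite lohi lexx.
have tau0 : tau n @[n --> \oo] --> 0.
  apply: (psi_vanishes hH hE HX iidX K0).
  have := test (tail K%:R) mu_lo (tail_bounded_lip _) lolo.
  rewrite tail_small ?inK//; apply => x xlu.
  by rewrite tail_small ?inK.
have bt := trunc_bounded_lip R K.
have btN := bounded_lip_opp bt.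
have tid x : mu_lo <= x <= mu_up -> trunc K x = x by move=> /inK; exact: trunc_id.
have Eup : E (fun w => trunc K (S n w)) @[n --> \oo] --> mu_up.
  have := test (trunc K) mu_up bt upup.
  by rewrite (tid _ upup); apply => x xlu; rewrite (tid x xlu); case/andP: xlu.
have Elo : E (fun w => - trunc K (S n w)) @[n --> \oo] --> - mu_lo.
  have := test (fun x => - trunc K x) mu_lo btN lolo.
  rewrite (tid _ lolo); apply => x xlu.
  by rewrite (tid x xlu) lerN2; case/andP: xlu.
have lu n : lo n <= up n := lo_le_up hH hE HX (trunc_bounded_lip R n).
have mid n m : lo n <= m <= up n -> trunc K m = m.
  move=> /(trunc_mean_bound hH hE HX)/andP[m1 m2]; apply: trunc_id.
  by rewrite ler_norml; apply/andP; split; lra.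
have lon n : lo n <= lo n <= up n by rewrite lexx lu.
have upn n : lo n <= up n <= up n by rewrite lexx lu.
split => //.
  apply/cvgrPdist_le => e e0; have e20 : 0 < e / 2 by lra.
  have wl := weak_law hH hE HX iidX tau0 bt e20.
  move/cvgrPdist_le : Eup => /(_ _ e20) Eup.
  near=> n.
  have [ub lb] : (forall A, (forall m, lo n <= m <= up n -> trunc K m <= A) ->
      E (fun w => trunc K (S n w)) <= A + e / 2) /\
    (forall m, lo n <= m <= up n ->
      trunc K m - e / 2 <= E (fun w => trunc K (S n w))) by near: n.
  have : `|mu_up - E (fun w => trunc K (S n w))| <= e / 2 by near: n.
  have := lb _ (upn n); rewrite (mid n)//.
  have /ub : forall m, lo n <= m <= up n -> trunc K m <= up n.
    by move=> m mlu; rewrite (mid n)//; case/andP: mlu.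
  by move=> h1 h2; rewrite !ler_norml => /andP[h3 h4]; apply/andP; split; lra.
apply/cvgrPdist_le => e e0; have e20 : 0 < e / 2 by lra.
have wl := weak_law hH hE HX iidX tau0 btN e20.
move/cvgrPdist_le : Elo => /(_ _ e20) Elo.
near=> n.
have [ub lb] : (forall A, (forall m, lo n <= m <= up n -> - trunc K m <= A) ->
    E (fun w => - trunc K (S n w)) <= A + e / 2) /\
  (forall m, lo n <= m <= up n ->
    - trunc K m - e / 2 <= E (fun w => - trunc K (S n w))) by near: n.
have : `|- mu_lo - E (fun w => - trunc K (S n w))| <= e / 2 by near: n.
have := lb _ (lon n); rewrite (mid n)//.
have /ub : forall m, lo n <= m <= up n -> - trunc K m <= - lo n.
  by move=> m mlu; rewrite (mid n)// lerN2; case/andP: mlu.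
by move=> h1 h2; rewrite !ler_norml => /andP[h3 h4]; apply/andP; split; lra.
Unshelve. all: by end_near. Qed.

(** [phi] lies between a Lipschitz function [l] with value almost [phi m] near a
    maximum point [m], and a Lipschitz function [g] that is almost [phi m] near the
    whole interval. *)
Lemma lln_sufficient : tau n @[n --> \oo] --> 0 ->
  up n @[n --> \oo] --> mu_up -> lo n @[n --> \oo] --> mu_lo ->
  forall phi : R -> R, Cb phi ->
    expect_Cb E phi (S n) @[n --> \oo] --> max_on phi.
Proof.
move=> tau0 upc loc phi Cphi; have /CbP[cphi _] := Cphi.
have [m + mmax] := EVT_max lohi (continuous_subspaceT cphi).
rewrite in_itv/= => mlu.
have {}mmax x : mu_lo <= x <= mu_up -> phi x <= phi m.
  by move=> xlu; apply: mmax; rewrite in_itv.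
rewrite (max_onE mlu mmax).
apply/cvgrPdist_le => e e0; have e40 : 0 < e / 4 by lra.
have [d [B [d0 B0 phig]]] := wall_majorant Cphi lohi mmax e40.
have CNphi : Cb (fun x => - phi x).
  have := Cb_scale (- 1) Cphi; congr Cb.
  by apply/funext => x; rewrite mulN1r.
have mm x : m <= x <= m -> - phi x <= - phi m.
  by move=> /le_anti->.
have [d' [B' [d'0 B'0 phil]]] := wall_majorant CNphi (lexx m) mm e40.
pose g x := phi m + e / 4 + B * wall d mu_lo mu_up x.
pose l x := - (- phi m + e / 4 + B' * wall d' m m x).
have bg : bounded_lip g.
  apply: bounded_lip_add; first exact: bounded_lip_cst.
  by apply: bounded_lip_scale; exact: wall_bounded_lip.
have bl : bounded_lip l.
  apply: bounded_lip_opp; apply: bounded_lip_add; first exact: bounded_lip_cst.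
  by apply: bounded_lip_scale; exact: wall_bounded_lip.
have lphi x : l x <= phi x by rewrite /l lerNl; exact: phil.
have [r r0 [rg rl]] : exists2 r, 0 < r & B * (d^-1 * r) <= e / 4 /\
    B' * (d'^-1 * r) <= e / 4.
  have small b f : 0 <= b -> 0 < f -> exists2 r, 0 < r & b * (f^-1 * r) <= e / 4.
    move=> b0 f0; exists (f * (e / 4 / (b + 1))).
      by rewrite mulr_gt0// divr_gt0//; lra.
    rewrite mulKf ?gt_eqF// mulrCA ger_pMr// ler_pdivrMr; lra.
  have [r1 r10 H1] := small B d B0 d0; have [r2 r20 H2] := small B' d' B'0 d'0.
  exists (Num.min r1 r2); first by rewrite lt_min r10.
  split; [apply: le_trans H1|apply: le_trans H2]; rewrite ler_wpM2l// ler_wpM2l//.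
  - by rewrite invr_ge0 ltW.
  - by rewrite ge_min lexx.
  - by rewrite invr_ge0 ltW.
  - by rewrite ge_min lexx orbT.
have wlg := weak_law hH hE HX iidX tau0 bg e40.
have wll := weak_law hH hE HX iidX tau0 bl e40.
move/cvgrPdist_le : upc => /(_ _ r0) upc.
move/cvgrPdist_le : loc => /(_ _ r0) loc.
near=> n.
have [ubg _] : (forall A, (forall m, lo n <= m <= up n -> g m <= A) ->
      E (fun w => g (S n w)) <= A + e / 4) /\
    (forall m, lo n <= m <= up n ->
      g m - e / 4 <= E (fun w => g (S n w))) by near: n.
have [_ lbl] : (forall A, (forall m, lo n <= m <= up n -> l m <= A) ->
      E (fun w => l (S n w)) <= A + e / 4) /\
    (forall m, lo n <= m <= up n ->
      l m - e / 4 <= E (fun w => l (S n w))) by near: n.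
have upr : `|mu_up - up n| <= r by near: n.
have lor : `|mu_lo - lo n| <= r by near: n.
have lu : lo n <= up n := lo_le_up hH hE HX (trunc_bounded_lip R n).
have upper : expect_Cb E phi (S n) <= phi m + e / 4 + e / 4 + e / 4.
  apply: (@le_trans _ _ (E (fun w => g (S n w)))).
    rewrite -(expect_CbE hH hE (HS n) bg).
    by apply: (expect_Cb_mono hH hE) => //; exact: bounded_lip_Cb.
  apply: ubg => x /andP[x1 x2]; rewrite /g lerD2l; apply: le_trans rg.
  rewrite ler_wpM2l//; apply: wall_near => //.
  - exact: ltW.
  - by apply: le_trans (le_trans (ler_norm _) lor); rewrite lerD2l lerN2.
  - apply: le_trans upr; rewrite distrC; apply: le_trans (ler_norm _).
    by rewrite lerD2r.
have lower : phi m - e / 4 - e / 4 - e / 4 <= expect_Cb E phi (S n).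
  apply: (@le_trans _ _ (E (fun w => l (S n w)))); last first.
    rewrite -(expect_CbE hH hE (HS n) bl).
    by apply: (expect_Cb_mono hH hE) => //; exact: bounded_lip_Cb.
  have [mn mnlu [mn1 mn2]] := nearest_point mlu lu lor upr.
  apply: le_trans (lbl mn mnlu); rewrite lerD2r /l !opprD opprK lerD2l lerN2.
  apply: le_trans rl; rewrite ler_wpM2l//.
  by apply: wall_near => //; exact: ltW.
by rewrite ler_norml; apply/andP; split; lra.
Unshelve. all: by end_near. Qed.

End LawOfLargeNumbers.


Theorem theorem4p6 (R : realType) (Omega : Type) (H : set (Omega -> R))
    (E : (Omega -> R) -> R) (X : nat -> Omega -> R) (mu_lo mu_up : R) :
  rv_space H -> sublinear_expectation H E ->
  (forall i, H (X i)) -> iid E X -> mu_lo <= mu_up ->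
  (forall phi : R -> R, Cb phi ->
     expect_Cb E phi (fun w => (\sum_(i < n) X i w) / n%:R) @[n --> \oo]
       --> sup [set phi mu | mu in `[mu_lo, mu_up]])
  <->
  [/\ E (fun w => psi n (X 0%N w)) @[n --> \oo] --> 0,
      E (fun w => Num.min (Num.max (- n%:R) (X 0%N w)) n%:R) @[n --> \oo]
        --> mu_up
    & - E (fun w => Num.min (Num.max (- n%:R) (- X 0%N w)) n%:R) @[n --> \oo]
        --> mu_lo].
Proof.
move=> hH hE HX iidX lohi.
have loE : (fun n => - E (fun w => trunc n (- X 0%N w))) =
    (fun n => - E (fun w => - trunc n (X 0%N w))).
  by apply/funext => n; congr (- E _); apply/funext => w; exact: truncN.
split=> [/(lln_necessary hH hE HX iidX lohi)[tau0 upc loc]|[tau0 upc loc]].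
  by split=> //; move: loc; rewrite -loE.
apply: (lln_sufficient hH hE HX iidX lohi) => //.
by rewrite -loE.
Qed.
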